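(* If a unitary $\mathrm{BT}_1$ module $\widetilde{M}$ over $k$ is indecomposable as a unitary $\mathrm{BT}_1$ module, then $\widetilde{M}$ is isomorphic to a unitary unicycle, a unitary bicycle, a Serre unicycle, or a Serre bicycle.
   Context: $k$ is an algebraically closed field of prime characteristic $p>2$. Words. A word is a nonempty finite string $w=u_{\ell-1}\cdots u_0$ in the alphabet $\{\mathtt f,\mathtt v\}$; $\ell(w)=\ell$ is its length. Juxtaposition is concatenation and $z^n$ is the concatenation of $n$ copies of $z$. The rotation operator is $\tau(u_{\ell-1}\cdots u_0)=u_0u_{\ell-1}\cdots u_1$. The dual word $w^\star$ is obtained by exchanging $\mathtt f$ and $\mathtt v$. $w$ is self-dual if $w^\star=\tau^n(w)$ for some $n$; $w$ is primitive if it is not of the form $z^n$ with $n>1$. $\mathrm{BT}_1$ modules. A $\mathrm{BT}_1$ module is a triple $(M,F,V)$ with $M$ a finite-dimensional $k$-vector space, $F:M\to M$ Frobenius-linear, $V:M\to M$ inverse-Frobenius-linear, $\ker F=\operatorname{im}V$ and $\ker V=\operatorname{im}F$. For a word $w=u_{\ell-1}\cdots u_0$, $\overline M(w)$ is the $\mathrm{BT}_1$ module with $k$-basis $a_0,\dots,a_{\ell-1}$ (indices mod $\ell$) and: $F(a_j)=a_{j+1}$ if $u_j=\mathtt f$, $F(a_j)=0$ if $u_j=\mathtt v$; $V(a_{j+1})=a_j$ if $u_j=\mathtt v$, $V(a_{j+1})=0$ if $u_j=\mathtt f$. A polarized $\mathrm{BT}_1$ module $(M,F,V,\lambda)$ is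 a $\mathrm{BT}_1$ module with a symplectic (bilinear, alternating, non-degenerate) pairing $\lambda:M\times M\to k$ with $\lambda(F(x),y)=\lambda(x,V(y))^p$. A unitary $\mathrm{BT}_1$ module is a tuple $(M,F,V,\lambda,M=M_0\oplus M_1)$ where $(M,F,V,\lambda)$ is a polarized $\mathrm{BT}_1$ module, $F$ and $V$ exchange $M_0$ and $M_1$ (i.e. map $M_i$ into $M_{1-i}$), and $M_0,M_1$ are Lagrangian for $\lambda$. Isomorphisms are $k$-linear isomorphisms respecting all the structure; direct sums are orthogonal and graded. Indecomposable means nonzero and not isomorphic to a direct sum of two nonzero unitary $\mathrm{BT}_1$ modules. Unitary unicycle: $\widetilde M(w)$, where $w=yy^\star$ is primitive with $y$ of odd length $\ell$. Its underlying $\mathrm{BT}_1$ module is $\overline M(w)$ with basis $a_0,\dots,a_{2\ell-1}$; fix $c\in k^\times$ with $c^{p^\ell}=-c$; $\lambda(a_i,a_j)=c^{p^i}$ if $j\equiv i+\ell \pmod{2\ell}$ and $0$ otherwise; $M_0=\operatorname{span}\{a_j: j\text{ even}\}$, $M_1=\operatorname{span}\{a_j:j\text{ odd}\}$. For $w$ of even length, $\widetilde M(w,w^\star)$ has underlying $\mathrm{BT}_1$ module $\overline M(w)\oplus\overline M(w^\star)$, with standard bases $a_0,\dots,a_{\ell-1}$ and $b_0,\dots,b_{\ell-1}$; $\lambda$ is the symplectic form with $\lambda(a_i,b_j)=\delta_{i,j}$, $\lambda(a_i,a_j)=\lambda(b_i,b_j)=0$; $M_0=\operatorname{span}\{a_j: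 j\text{ even}\}\oplus\operatorname{span}\{b_j: j\text{ odd}\}$ and $M_1=\operatorname{span}\{a_j: j\text{ odd}\}\oplus\operatorname{span}\{b_j: j\text{ even}\}$. It is called a unitary bicycle if $w$ is primitive and non-self-dual; a Serre unicycle if $w$ is primitive and self-dual with $4\mid\ell(w)$; a Serre bicycle if $w=zz$ with $z$ primitive of odd length. *)

(* Defs.v *)
From HB Require Import structures.
From mathcomp Require Import all_boot all_algebra.

Set Implicit Arguments.
Unset Strict Implicit.
Unset Printing Implicit Defensive.

Import GRing.Theory.
Local Open Scope ring_scope.

(** * Words *)

(* The letter f is [true] and the letter v is [false].  A word is written from
   left to right as u_(l-1) ... u_0, so that u_j is the j-th entry from the
   right, and juxtaposition is [++].  Words are nonempty by convention, which
   [primitive] enforces. *)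
Definition word := seq bool.

Definition letter (w : word) (j : nat) : bool := nth false (rev w) j.

Definition rotate (w : word) : word := rotr 1 w.

Definition dual (w : word) : word := map negb w.

Definition power (z : word) (n : nat) : word := flatten (nseq n z).

Definition self_dual (w : word) : Prop := exists n, dual w = iter n rotate w.

Definition primitive (w : word) : Prop :=
  w <> [::] /\ forall z n, (1 < n)%N -> w <> power z n.

(** * BT_1 modules *)

(* The records below only carry the underlying data; the axioms are the
   predicates [is_BT1], [is_polarization] and [is_unitary_BT1].  The
   characteristic p is a parameter of the latter. *)
Record BT1_data (k : fieldType) := BT1Data {
  carrier :> vectType k;
  Fr : carrier -> carrier;
  Ve : carrier -> carrier
}.

Definition frobenius_linear (k : fieldType) (p : nat) (M : vectType k)
    (F : M -> M) : Prop :=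
  {morph F : x y / x + y} /\ forall a x, F (a *: x) = a ^+ p *: F x.

(* Over a perfect field of characteristic p this says that
   V (a *: x) = a^(1/p) *: V x. *)
Definition inv_frobenius_linear (k : fieldType) (p : nat) (M : vectType k)
    (V : M -> M) : Prop :=
  {morph V : x y / x + y} /\ forall a x, V (a ^+ p *: x) = a *: V x.

Definition is_BT1 (k : fieldType) (p : nat) (M : BT1_data k) : Prop :=
  [/\ frobenius_linear p (@Fr k M),
      inv_frobenius_linear p (@Ve k M),
      forall x : M, Fr x = 0 <-> exists y, x = Ve y
    & forall x : M, Ve x = 0 <-> exists y, x = Fr y].

Definition BT1_dsum (k : fieldType) (M N : BT1_data k) : BT1_data k :=
  @BT1Data k (M * N)%type (fun x => (Fr x.1, Fr x.2))
    (fun x => (Ve x.1, Ve x.2)).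

Definition symplectic (k : fieldType) (M : vectType k) (lam : M -> M -> k)
    : Prop :=
  [/\ (forall x, scalar (lam x)) /\ (forall y, scalar (lam^~ y)),
      forall x, lam x x = 0
    & forall x, (forall y, lam x y = 0) -> x = 0].

Definition lagrangian (k : fieldType) (M : vectType k) (lam : M -> M -> k)
    (U : {vspace M}) : Prop :=
  forall x, x \in U <-> (forall y, y \in U -> lam x y = 0).

Definition is_polarization (k : fieldType) (p : nat) (M : BT1_data k)
    (lam : M -> M -> k) : Prop :=
  symplectic lam /\ forall x y, lam (Fr x) y = lam x (Ve y) ^+ p.

(* [grade M false] is M_0 and [grade M true] is M_1. *)
Record unitary_data (k : fieldType) := UnitaryData {
  bt1 :> BT1_data k;
  pol : bt1 -> bt1 -> k;
  grade : bool -> {vspace bt1}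
}.

Definition is_unitary_BT1 (k : fieldType) (p : nat) (M : unitary_data k)
    : Prop :=
  [/\ is_BT1 p M,
      is_polarization p (@pol k M),
      (grade M false + grade M true = fullv)%VS /\
      (grade M false :&: grade M true = 0)%VS,
      forall i (x : M), x \in grade M i ->
        Fr x \in grade M (~~ i) /\ Ve x \in grade M (~~ i)
    & forall i, lagrangian (@pol k M) (grade M i)].

Definition unitary_iso (k : fieldType) (M N : unitary_data k) : Prop :=
  exists phi : {linear M -> N},
    [/\ bijective phi,
        forall x, phi (Fr x) = Fr (phi x),
        forall x, phi (Ve x) = Ve (phi x),
        forall x y, pol (phi x) (phi y) = pol x y
      & forall i x, (phi x \in grade N i) = (x \in grade M i)].

Definition unitary_dsum (k : fieldType) (M N : unitary_data k)
    : unitary_data k :=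
  @UnitaryData k (BT1_dsum M N)
    (fun x y : M * N => pol x.1 y.1 + pol x.2 y.2)
    (fun i => (linfun (fst : (M * N)%type -> M) @^-1: grade M i :&:
               linfun (snd : (M * N)%type -> N) @^-1: grade N i)%VS).

Definition nonzero (k : fieldType) (M : vectType k) : Prop :=
  exists x : M, x != 0.

Definition indecomposable (k : fieldType) (p : nat) (M : unitary_data k)
    : Prop :=
  nonzero M /\
  ~ exists M1 M2 : unitary_data k,
      [/\ is_unitary_BT1 p M1, is_unitary_BT1 p M2, nonzero M1, nonzero M2
        & unitary_iso M (unitary_dsum M1 M2)].

(** * Modules attached to words *)

Lemma ex_root (k : closedFieldType) (p : nat) (x : k) :
  exists y : k, (0 < p)%N ==> (y ^+ p == x).
Proof.
case: p => [|p]; first by exists 0.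
have [y yP] := @solve_monicpoly k p.+1 (fun i => if i == 0%N then x else 0) isT.
exists y => /=; rewrite yP big_ord_recl /= mulr1 big1 ?addr0 // => i _.
by rewrite mul0r.
Qed.

(* A p-th root, unique in characteristic p. *)
Definition root_p (k : closedFieldType) (p : nat) (x : k) : k :=
  xchoose (ex_root p x).

(* The basis vector a_j is [delta_mx 0 j], and [ordS j] is j + 1 modulo the
   length of the word. *)
Definition word_module (k : closedFieldType) (p : nat) (w : word)
    : BT1_data k :=
  @BT1Data k 'rV[k]_(size w)
    (fun x : 'rV[k]_(size w) =>
       \sum_(j < size w | letter w j) x 0 j ^+ p *: delta_mx 0 (ordS j))
    (fun x : 'rV[k]_(size w) =>
       \sum_(j < size w | ~~ letter w j)
          root_p p (x 0 (ordS j)) *: delta_mx 0 j).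

(* The constants c allowed for a word y of length l. *)
Definition unicycle_constant (k : fieldType) (p l : nat) (c : k) : Prop :=
  c != 0 /\ c ^+ (p ^ l) = - c.

Definition unicycle (k : closedFieldType) (p : nat) (y : word) (c : k)
    : unitary_data k :=
  let w := y ++ dual y in
  let a (j : 'I_(size w)) : 'rV[k]_(size w) := delta_mx 0 j in
  @UnitaryData k (word_module k p w)
    (fun x z : 'rV[k]_(size w) =>
       \sum_(i < size w)
         \sum_(j < size w | j == (i + size y)%N %[mod (size y).*2])
           c ^+ (p ^ i) * x 0 i * z 0 j)
    (fun e => (\sum_(j < size w | odd j == e) <[a j]>)%VS).

Definition bicycle (k : closedFieldType) (p : nat) (w : word)
    : unitary_data k :=
  let a (j : 'I_(size w)) : 'rV[k]_(size w) * 'rV[k]_(size (dual w)) :=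
    (delta_mx 0 j, 0) in
  let b (j : 'I_(size (dual w))) : 'rV[k]_(size w) * 'rV[k]_(size (dual w)) :=
    (0, delta_mx 0 j) in
  @UnitaryData k (BT1_dsum (word_module k p w) (word_module k p (dual w)))
    (fun x z : 'rV[k]_(size w) * 'rV[k]_(size (dual w)) =>
       \sum_(i < size w) \sum_(j < size (dual w) | j == i :> nat)
         (x.1 0 i * z.2 0 j - x.2 0 j * z.1 0 i))
    (fun e =>
       (\sum_(j < size w | odd j == e) <[a j]> +
        \sum_(j < size (dual w) | odd j == ~~ e) <[b j]>)%VS).

(* [c] is the choice of the constant made for each unicycle. *)
Definition iso_unitary_unicycle (k : closedFieldType) (p : nat)
    (c : word -> k) (M : unitary_data k) : Prop :=
  exists y : word,
    [/\ odd (size y), primitive (y ++ dual y)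
      & unitary_iso M (unicycle p y (c y))].

Definition iso_unitary_bicycle (k : closedFieldType) (p : nat)
    (M : unitary_data k) : Prop :=
  exists w : word,
    [/\ ~~ odd (size w), primitive w, ~ self_dual w
      & unitary_iso M (bicycle k p w)].

Definition iso_Serre_unicycle (k : closedFieldType) (p : nat)
    (M : unitary_data k) : Prop :=
  exists w : word,
    [/\ (4 %| size w)%N, primitive w, self_dual w
      & unitary_iso M (bicycle k p w)].

Definition iso_Serre_bicycle (k : closedFieldType) (p : nat)
    (M : unitary_data k) : Prop :=
  exists z : word,
    [/\ odd (size z), primitive z & unitary_iso M (bicycle k p (z ++ z))].

(* Main.v *)
Require Import Defs.
From HB Require Import structures.
From mathcomp Require Import all_boot all_algebra zify.
From Stdlib Require Import Classical.

Set Implicit Arguments.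
Unset Strict Implicit.
Unset Printing Implicit Defensive.

Import GRing.Theory.
Local Open Scope ring_scope.

(** The filtration comes with no splitting stable under [F] and [V], so fixed vectors in a
    subquotient would not suffice: they must be lifted to [M] itself. This is why one turn of the
    cycle is made backwards. Against a letter v one applies [V], against a letter f a chosen
    semilinear section of [F]; the composite is an inverse-Frobenius-linear operator [Psi] on all of
    [high b], where forward steps along v would be multivalued. [Psi] is injective modulo [low b],
    which yields a vector outside [low b] that is fixed modulo [low b]; since [x - Psi x] takes
    every value on [low b], this vector can be corrected to a truly fixed one.

    Least dimension enters through a conservation law: from the bottom to the top of a block, the
    dimensions of [F(U)] and of [V^-1(U)] together grow by the dimension of the block, while each
    grows by 0 or by at least the minimum.

    A step changes the degree, and a block is determined by its letters only together with its
    degree. Hence only even periods of the letters are periods of the cycle, and only even shifts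
    that negate the letters would carry a contradiction with 4 not dividing the length; the two
    Serre types come from this parity. *)

(** In each degree [e], the subspaces generated from [0] and [M_e] by the two
    operations [U |-> F(U)] and [U |-> V^-1(U)] form a chain which is stable
    under orthogonals.  A subquotient ("block") of least dimension in this chain
    is moved isomorphically by exactly one of [F] and [V^-1], onto another such
    block; hence it is periodic, its letters form a word, and a periodic block is
    determined by its degree and its letters.  The return map of a periodic block
    is semilinear, so it has fixed vectors (Lang), and these lift to cyclic chains
    of vectors of [M], that is, to maps from the module of the word.  A chain that
    is paired nontrivially with a chain in the dual block spans together with it a
    submodule with triangular Gram matrix, thus an orthogonal summand, thus [M]
    itself.  As [p] is odd, the unipotent change of form has a square root, which
    makes the Gram matrix standard.  If the block and its dual lie in one cycle,
    the two chains can be taken equal, by a hermitian form argument, and [M] is a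
    unicycle; otherwise [M] is the bicycle of the word, and the fact that letters
    and degree determine the block restricts the word to the three listed cases. *)

(** * Linear and semilinear algebra *)

Section DependenceModulo.
Variables (K : fieldType) (V : vectType K) (A : {vspace V}) (X : nat -> V).

Lemma mem_add_sum_lines n v :
  v \in (A + \sum_(i < n) <[X i]>)%VS <->
  exists c : nat -> K, v - \sum_(i < n) c i *: X i \in A.
Proof.
elim: n v => [|n IHn] v.
  rewrite big_ord0 addv0; split=> [Av|[c]]; last by rewrite big_ord0 subr0.
  by exists (fun=> 0); rewrite big_ord0 subr0.
rewrite big_ord_recr addvA; split=> [/memv_addP[u /IHn[c cP] [w /vlineP[a ->] ->]]|[c]].
  exists (fun i => if i == n then a else c i).
  rewrite big_ord_recr /= eqxx opprD addrACA subrr addr0.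
  under eq_bigr => i _ do rewrite (ltn_eqF (ltn_ord i)).
  by [].
rewrite big_ord_recr /= opprD addrA -addrAC => cP.
rewrite -(subrK (c n *: X n) v) memv_add ?memvZ ?memv_line //.
by apply/IHn; exists c.
Qed.

(** [n] is the first index at which [X n] falls into [A] plus the span of its predecessors. It
    exists because the dimension of these spans cannot grow forever, and its minimality makes the
    earlier vectors independent modulo [A]. *)
Lemma dependence_modulo :
  exists n (a : nat -> K), X n - \sum_(i < n) a i *: X i \in A /\
    forall c : nat -> K, \sum_(i < n) c i *: X i \in A ->
      forall i, (i < n)%N -> c i = 0.
Proof.
pose W n := (A + \sum_(i < n) <[X i]>)%VS.
have WS n : W n.+1 = (W n + <[X n]>)%VS by rewrite /W big_ord_recr addvA.
have [n Xn]: exists n, X n \in W n.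
  case: (classic (exists n, X n \in W n)) => // nX; exfalso.
  have dimW n : (n <= \dim (W n))%N.
    elim: n => // n IHn; rewrite (leq_ltn_trans IHn) // WS.
    rewrite (ltn_leqif (dimv_leqif_sup (addvSl _ _))).
    apply: contra_notN nX => sub; exists n.
    by apply: (subvP sub); apply: (subvP (addvSr _ _)); apply: memv_line.
  by have := leq_trans (dimW _) (dimvS (subvf (W (\dim {:V}).+1))); rewrite ltnn.
have [m Wm min_m] := ex_minnP (ex_intro (fun n => X n \in W n) n Xn).
have [a Aa] := (mem_add_sum_lines _ _).1 Wm; exists m, a; split=> // c Ac i lt_im.
apply/eqP/negPn/negP => ci.
(* The last nonzero coefficient, at index [j], would express [X j] by its predecessors modulo [A],
   against the minimality of [m]. *)
pose P i := (i < m)%N && (c i != 0).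
have exP : exists i, P i by exists i; rewrite /P lt_im.
have ubP j : P j -> (j <= m)%N by move=> /andP[/ltnW].
case: (ex_maxnP exP ubP) => j Pj max_j; have /andP[lt_jm cj] := Pj.
suff /min_m : X j \in W j by rewrite leqNgt lt_jm.
apply/mem_add_sum_lines; exists (fun i => - (c j)^-1 * c i).
rewrite -[X in X \in A](scalerK cj) memvZ // scalerBr scaler_sumr -sumrN.
have -> : c j *: X j + \sum_(i0 < j) - (c j *: ((- (c j)^-1 * c i0) *: X i0)) =
          \sum_(i < m) c i *: X i; last by [].
rewrite -(big_mkord xpredT (fun i => c i *: X i)).
rewrite (big_cat_nat (n := j.+1)) //= [X in _ = _ + X]big_nat_cond.
rewrite [X in _ = _ + X]big1 ?addr0; last first.
  move=> l /andP[/andP[jl lm] _]; apply/eqP; rewrite scaler_eq0; apply/orP; left.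
  apply/negPn/negP => cl; have := max_j l; rewrite /P lm cl => /(_ isT).
  by rewrite leqNgt jl.
rewrite big_nat_recr //= addrC; congr (_ + _); rewrite big_mkord.
by apply: eq_bigr => l _; rewrite !scalerA mulrA mulrN divff // mulN1r scaleNr opprK.
Qed.

End DependenceModulo.

Section Semilinear.
Variables (K : fieldType) (V W : vectType K) (th th' : K -> K) (f : V -> W).
Hypothesis fD : {morph f : x y / x + y}.
Hypothesis fZ : forall a x, f (a *: x) = th a *: f x.
Hypothesis th0 : th 0 = 0.
Hypothesis th'K : cancel th' th.

Lemma semilinear0 : f 0 = 0.
Proof. by apply: (addrI (f 0)); rewrite -fD !addr0. Qed.

Lemma semilinearN x : f (- x) = - f x.
Proof. by apply: (addrI (f x)); rewrite -fD !subrr semilinear0. Qed.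

Lemma semilinearB x y : f (x - y) = f x - f y.
Proof. by rewrite fD semilinearN. Qed.

Lemma semilinear_sum (I : Type) (r : seq I) (P : pred I) (x : I -> V) :
  f (\sum_(i <- r | P i) x i) = \sum_(i <- r | P i) f (x i).
Proof. by rewrite (big_morph f fD semilinear0). Qed.

(** The span of the images of a basis is no larger than the set-theoretic image, because [th] is
    onto. *)
Definition semilinear_image (U : {vspace V}) : {vspace W} :=
  <<[seq f x | x <- vbasis U]>>%VS.

Lemma mem_span_semilinear n (X : n.-tuple V) y :
  y \in <<[seq f x | x <- X]>>%VS -> exists2 x, x \in <<X>>%VS & y = f x.
Proof.
move=> /(@coord_span _ _ _ (map_tuple f X)) ->.
exists (\sum_(i < n) th' (coord (map_tuple f X) i y) *: X`_i).
  by rewrite memv_suml // => i _; rewrite memvZ // memv_span // mem_nth ?size_tuple.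
rewrite semilinear_sum; apply: eq_bigr => i _.
by rewrite fZ th'K (nth_map 0) ?size_tuple.
Qed.

Lemma mem_semilinear_image U y :
  y \in semilinear_image U <-> exists2 x, x \in U & y = f x.
Proof.
split=> [/mem_span_semilinear[x]|[x Ux ->]].
  by rewrite (span_basis (vbasisP U)); exists x.
rewrite (coord_vbasis Ux) semilinear_sum memv_suml // => i _.
by rewrite fZ memvZ // memv_span // map_f // mem_nth ?size_tuple.
Qed.

(** Rank-nullity for semilinear maps: a basis of a complement of the kernel in [U] has a free image,
    since a relation among the images pulls back through [th']. *)
Lemma dim_semilinear_image U (N : {vspace V}) : (forall x, x \in N <-> f x = 0) ->
  (\dim (semilinear_image U) + \dim (U :&: N))%N = \dim U.
Proof.
move=> kerP; rewrite -[RHS](dimv_cap_compl U N) addnC; congr (_ + _)%N.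
set D := (U :\: N)%VS.
suff /size_basis -> : basis_of (semilinear_image U) (map_tuple f (vbasis D)) by [].
rewrite /basis_of; apply/andP; split; last first.
  apply/freeP => c c0 i; rewrite -(th'K (c i)).
  have fc0 : f (\sum_i th' (c i) *: (vbasis D)`_i) = 0.
    rewrite -[RHS]c0 semilinear_sum; apply: eq_bigr => j _.
    by rewrite fZ th'K (nth_map 0) ?size_tuple.
  have /freeP free_D := basis_free (vbasisP D).
  rewrite (free_D (fun i => th' (c i))) ?th0 //.
  apply/eqP; rewrite -memv0 -(capv_diff U N) memv_cap; apply/andP; split.
    by rewrite memv_suml // => j _; rewrite memvZ // vbasis_mem // mem_nth ?size_tuple.
  exact/kerP.
rewrite eqEsubv; apply/andP; split; apply/subvP => y.
  case/mem_span_semilinear=> x; rewrite (span_basis (vbasisP D)) => Dx ->.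
  by apply/mem_semilinear_image; exists x => //; apply: (subvP (diffvSl _ _) _ Dx).
case/mem_semilinear_image => x Ux ->.
have : x \in (D + U :&: N)%VS by rewrite addv_diff_cap.
case/memv_addP=> x1 Dx1 [x2 /memv_capP[_ /kerP fx2] ->].
rewrite fD fx2 addr0 (coord_vbasis Dx1) semilinear_sum memv_suml // => i _.
by rewrite fZ memvZ // memv_span // map_f // mem_nth ?size_tuple.
Qed.

Lemma semilinear_section U : {morph th' : a b / a + b} -> {morph th' : a b / a * b} ->
  exists g : W -> V, [/\ {morph g : x y / x + y}, forall a y, g (a *: y) = th' a *: g y
    & forall y, y \in semilinear_image U -> g y \in U /\ f (g y) = y].
Proof.
move=> th'D th'M; set D := semilinear_image U.
have [i|s sP] := @fin_all_exists _ _ (fun (i : 'I_(\dim D)) x => x \in U /\ f x = (vbasis D)`_i).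
  have /mem_semilinear_image[x Ux ->] : (vbasis D)`_i \in D.
    by rewrite vbasis_mem // mem_nth ?size_tuple.
  by exists x.
exists (fun y => \sum_i th' (coord (vbasis D) i y) *: s i); split=> [x y|a y|y Dy].
- by rewrite -big_split; apply: eq_bigr => i _; rewrite linearD th'D scalerDl.
- by rewrite scaler_sumr; apply: eq_bigr => i _; rewrite linearZ th'M scalerA.
split; first by rewrite memv_suml // => i _; rewrite memvZ //; case: (sP i).
rewrite semilinear_sum [RHS](coord_vbasis Dy); apply: eq_bigr => i _.
by rewrite fZ th'K; case: (sP i) => _ ->.
Qed.

End Semilinear.

(** * Fixed vectors of inverse-Frobenius-linear maps *)

Section FrobeniusRoots.
Variables (k : closedFieldType) (p : nat).
Hypothesis hp : p \in [pchar k].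

Let p_gt0 : (0 < p)%N. Proof. exact/prime_gt0/(pcharf_prime hp). Qed.
Let p_gt1 : (1 < p)%N. Proof. exact/prime_gt1/(pcharf_prime hp). Qed.

Lemma exp_pcharD n (x y : k) : (x + y) ^+ (p ^ n) = x ^+ (p ^ n) + y ^+ (p ^ n).
Proof.
by rewrite exprDn_pchar // (eq_pnat _ (pcharf_eq hp)) pnatX pnat_id // (pcharf_prime hp).
Qed.

Lemma exp_pcharN n (x : k) : (- x) ^+ (p ^ n) = - x ^+ (p ^ n).
Proof.
apply: (addrI (x ^+ (p ^ n))).
by rewrite -exp_pcharD !subrr expr0n expn_eq0 -leqn0 leqNgt p_gt0.
Qed.

Lemma exp_pchar_inj n : injective (fun x : k => x ^+ (p ^ n)).
Proof.
move=> x y /eqP; rewrite -subr_eq0 -exp_pcharN -exp_pcharD expf_eq0.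
by rewrite subr_eq0 => /andP[_ /eqP].
Qed.

Lemma root_pK x : root_p p x ^+ p = x :> k.
Proof. by have /implyP/(_ p_gt0)/eqP := xchooseP (ex_root p x). Qed.

Lemma root_p_eq x y : (root_p p x == y :> k) = (x == y ^+ p).
Proof.
apply/eqP/eqP => [<-|->]; first by rewrite root_pK.
by apply: (@exp_pchar_inj 1); rewrite expn1 root_pK.
Qed.

Lemma exp_pK : cancel (fun x : k => x ^+ p) (root_p p).
Proof. by move=> x; apply/eqP; rewrite root_p_eq. Qed.

Lemma root_pD : {morph @root_p k p : x y / x + y}.
Proof.
move=> x y; apply/eqP; rewrite root_p_eq.
by have := @exp_pcharD 1; rewrite expn1 => ->; rewrite !root_pK.
Qed.

Lemma root_pM : {morph @root_p k p : x y / x * y}.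
Proof. by move=> x y; apply/eqP; rewrite root_p_eq exprMn !root_pK. Qed.

Lemma root_p0 : root_p p 0 = 0 :> k.
Proof. by apply/eqP; rewrite root_p_eq expr0n -leqn0 leqNgt p_gt0. Qed.

Lemma ex_root_exp (n : nat) (x : k) : (0 < n)%N -> exists y, y ^+ n = x.
Proof. by move=> n_gt0; have [y] := ex_root n x; rewrite n_gt0 => /eqP; exists y. Qed.

Section FixedVectors.
Variables (V : vectType k) (m : nat) (Psi : V -> V).
Hypothesis m_gt0 : (0 < m)%N.
Local Notation q := (p ^ m)%N.
Hypothesis PsiD : {morph Psi : x y / x + y}.
Hypothesis PsiZ : forall a x, Psi (a ^+ q *: x) = a *: Psi x.

Let q_gt1 : (1 < q)%N. Proof. by rewrite -(expn0 p) ltn_exp2l. Qed.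
Let qX_gt0 n : (0 < q ^ n)%N. Proof. by rewrite expn_gt0 (ltnW q_gt1). Qed.

Let rootq (x : k) : {y | y ^+ q = x}.
Proof. exact/sig_eqW/ex_root_exp/ltnW/q_gt1. Qed.

(* In the span of the iterates of a vector [v], where [Psi^n v] is the combination
   [a] of the previous ones, the equation [x - Psi x = c *: v] has triangular
   form: all coefficients of [x] are determined by the [q]-th root [t] of the last
   one, which is subject to a single polynomial equation. *)
Fixpoint fixed_coef (a : nat -> k) (c t : k) i : k :=
  if i is j.+1 then sval (rootq (fixed_coef a c t j + a j * t)) else c.

Lemma fixed_coefE a c t n :
  fixed_coef a c t n ^+ (q ^ n) = c + \sum_(i < n) (a i * t) ^+ (q ^ i).
Proof.
elim: n => [|n IHn]; first by rewrite big_ord0 addr0 expn0 expr1.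
rewrite big_ord_recr addrA -IHn /= expnS exprM; case: rootq => y /= ->.
by rewrite -!expnM exp_pcharD.
Qed.

(** Write [z] for [fixed_coef a c t]. The recursion makes [Psi x + c *: v] the combination of the
    first [n + 1] iterates with coefficients [z i], and the equation for [t] says [z n = t]. What
    remains of the difference is [- t] times the relation [Xn]. *)
Lemma sub_Psi_modulo (A : {vspace V}) v n (a : nat -> k) c t :
  iter n Psi v - \sum_(i < n) a i *: iter i Psi v \in A ->
  t ^+ (q ^ n) = c + \sum_(i < n) (a i * t) ^+ (q ^ i) ->
  forall x, x = \sum_(i < n) (fixed_coef a c t i + a i * t) *: iter i Psi v ->
  x - Psi x - c *: v \in A.
Proof.
move=> Xn tP x; set z := fixed_coef a c t => xE.
have zn : z n = t by apply: (@exp_pchar_inj (m * n)); rewrite expnM fixed_coefE.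
have Psi_x : Psi x + c *: v = \sum_(i < n.+1) z i *: iter i Psi v.
  rewrite big_ord_recl /= addrC xE; congr (_ + _).
  rewrite (semilinear_sum PsiD); apply: eq_bigr => i _.
  by rewrite /bump add1n /z /= -/z; case: rootq => y /= <-; rewrite PsiZ.
rewrite -addrA -opprD Psi_x xE big_ord_recr /= zn opprD addrA -sumrB.
under eq_bigr => i _ do rewrite -scalerBl addrC addKr mulrC -scalerA.
by rewrite -scaler_sumr -scalerBr -opprB scalerN memvN memvZ.
Qed.

Let size_subXn N (r : {poly k}) : (size r <= N)%N -> size ('X^N - r) = N.+1.
Proof. by move=> leN; rewrite size_polyDl ?size_polyXn // size_polyN ltnS. Qed.

(** The case [c = 1] over the zero subspace: the equation for [t] has degree [q ^ n], which is
    positive, hence a root. *)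
Lemma sub_Psi_surj (A : {vspace V}) v :
  (forall x, x \in A -> Psi x \in A) -> v \in A ->
  exists2 x, x \in A & x - Psi x = v.
Proof.
move=> stabA Av; have [n [a [Xn _]]] := dependence_modulo 0 (fun i => iter i Psi v).
have AX i : iter i Psi v \in A by elim: i => //= i; apply: stabA.
pose P := 'X^(q ^ n) - (1 + \sum_(i < n) (a i ^+ (q ^ i)) *: 'X^(q ^ i)) : {poly k}.
have /closed_rootP[t /rootP] : size P != 1.
  rewrite size_subXn ?eqSS -?lt0n // (leq_trans (size_polyD _ _)) //.
  rewrite geq_max size_poly1 qX_gt0 /= (leq_trans (size_sum _ _ _)) //.
  apply/bigmax_leqP => i _.
  by rewrite (leq_trans (size_scale_leq _ _)) // size_polyXn ltn_exp2l.
rewrite !hornerE horner_sum => /eqP; rewrite subr_eq0 => /eqP tP.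
have tP' : t ^+ (q ^ n) = 1 + \sum_(i < n) (a i * t) ^+ (q ^ i).
  by rewrite tP; congr (_ + _); apply: eq_bigr => i _; rewrite !hornerE exprMn.
have := sub_Psi_modulo Xn tP' erefl.
set x := \sum_(i < n) _; rewrite memv0 scale1r subr_eq0 => /eqP; exists x => //.
by rewrite memv_suml // => i _; rewrite memvZ.
Qed.

Lemma fixed_vector (A B : {vspace V}) :
  (A <= B)%VS -> A != B -> (forall x, x \in B -> Psi x \in B) ->
  (forall x, x \in B -> (Psi x \in A) = (x \in A)) ->
  exists x, [/\ x \in B, x \notin A & Psi x = x].
Proof.
move=> sAB neAB stabB stabA.
have /subvPn[v Bv Av]: ~~ (B <= A)%VS by apply: contra neAB => sBA; rewrite eqEsubv sAB.
have [n [a [Xn indep]]] := dependence_modulo A (fun i => iter i Psi v).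
have BX i : iter i Psi v \in B by elim: i => //= i; apply: stabB.
case: n => [|n] in Xn indep *; first by rewrite big_ord0 subr0 (negPf Av) in Xn.
(* If [a 0] vanished, the relation would be [Psi] of a combination of the earlier iterates with last
   coefficient 1; injectivity of [Psi] modulo [A] would put that combination in [A], against
   independence. *)
have a0 : a 0 != 0.
  apply: contra_eq_neq (oner_neq0 k) => a0.
  rewrite -(indep (fun i => if i == n then 1 else - a i.+1 ^+ q) _ n) ?eqxx //.
  rewrite -stabA; last by rewrite memv_suml // => i _; rewrite memvZ.
  congr (_ \in A): Xn; rewrite big_ord_recl a0 scale0r add0r (semilinear_sum PsiD).
  rewrite big_ord_recr /= eqxx -[in RHS](expr1n _ q) PsiZ scale1r addrC; congr (_ + _).
  rewrite -sumrN; apply: eq_bigr => i _; rewrite (ltn_eqF (ltn_ord i)) -scaleNr.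
  by rewrite -exp_pcharN PsiZ.
(* For [c = 0] the equation has the useless root 0, so it is divided by the unknown; the constant
   term becomes [- a 0], and every root is nonzero. *)
pose P := 'X^((q ^ n.+1).-1) - \sum_(i < n.+1) (a i ^+ (q ^ i)) *: 'X^((q ^ i).-1) : {poly k}.
have /closed_rootP[t /rootP Pt] : size P != 1.
  rewrite size_subXn ?eqSS -?lt0n.
    by rewrite -subn1 subn_gt0 (leq_trans q_gt1) // expnS leq_pmulr.
  rewrite (leq_trans (size_sum _ _ _)) //; apply/bigmax_leqP => i _.
  rewrite (leq_trans (size_scale_leq _ _)) // size_polyXn prednK //.
  by rewrite -ltnS prednK // ltn_exp2l.
have tP : t ^+ (q ^ n.+1).-1 = \sum_(i < n.+1) (a i ^+ (q ^ i)) * t ^+ (q ^ i).-1.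
  apply/eqP; rewrite -subr_eq0 -[X in _ == X]Pt /P !hornerE horner_sum; apply/eqP.
  by congr (_ - _); apply: eq_bigr => i _; rewrite !hornerE.
have t0 : t != 0.
  apply: contra_eq_neq tP => ->; rewrite big_ord_recl expn0 expr1 expr0 mulr1.
  rewrite big1 ?addr0 => [|i _].
    rewrite expr0n -subn1 subn_eq0 leqNgt (leq_trans q_gt1) ?expnS ?leq_pmulr //.
    by rewrite eq_sym.
  rewrite expr0n -subn1 subn_eq0 leqNgt (leq_trans q_gt1) ?mulr0 //.
  by rewrite lift0 expnS leq_pmulr.
have tP' : t ^+ (q ^ n.+1) = 0 + \sum_(i < n.+1) (a i * t) ^+ (q ^ i).
  rewrite add0r -(prednK (qX_gt0 n.+1)) exprSr tP mulr_suml; apply: eq_bigr => i _.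
  by rewrite exprMn -mulrA -exprSr prednK.
have := sub_Psi_modulo Xn tP' erefl; set x := \sum_(i < _) _.
rewrite scale0r subr0 => Ax.
have Bx : x \in B by rewrite memv_suml // => i _; rewrite memvZ.
have Ax' : x \notin A.
  apply/negP => /(indep (fun i => fixed_coef a 0 t i + a i * t)) x0.
  have zt : fixed_coef a 0 t n.+1 = t.
    by apply: (@exp_pchar_inj (m * n.+1)); rewrite expnM fixed_coefE.
  move: t0; rewrite -{1}zt /=; case: rootq => y /= /eqP.
  by rewrite x0 // expf_eq0 => /andP[_ ->].
(* So far [x] is fixed only modulo [A]; subtracting [d] in [A] with [d - Psi d = x - Psi x] makes it
   fixed. *)
have [|d Ad dP] := @sub_Psi_surj A (x - Psi x) _ Ax.
  by move=> y Ay; rewrite stabA // (subvP sAB).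
exists (x - d); split.
- by rewrite memvB // (subvP sAB).
- by apply: contra Ax' => Axd; rewrite -(subrK d x) memvD.
have Psi_x : Psi x = x - (d - Psi d) by rewrite dP opprB addrC subrK.
by rewrite (semilinearB PsiD) Psi_x opprD opprK addrA addrK.
Qed.

End FixedVectors.
End FrobeniusRoots.

(** * Canonical subspaces, blocks and chains *)

Section UnitaryTheory.
Variables (k : closedFieldType) (p : nat).
Hypothesis hp : p \in [pchar k].
Variable M : unitary_data k.
Hypothesis hM : is_unitary_BT1 p M.

Local Notation F := (@Fr k M).
Local Notation V := (@Ve k M).
Local Notation lam := (@pol k M).
Local Notation G := (grade M).

Lemma pol_addl x y z : lam (x + y) z = lam x z + lam y z.
Proof. by case: hM => _ [[[_ /(_ z 1 x y)]]]; rewrite scale1r mul1r. Qed.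

Lemma pol_addr x y z : lam x (y + z) = lam x y + lam x z.
Proof. by case: hM => _ [[[/(_ x 1 y z)]]]; rewrite scale1r mul1r. Qed.

Lemma pol0l z : lam 0 z = 0.
Proof. by apply: (addrI (lam 0 z)); rewrite -pol_addl !addr0. Qed.

Lemma pol0r z : lam z 0 = 0.
Proof. by apply: (addrI (lam z 0)); rewrite -pol_addr !addr0. Qed.

Lemma pol_scalel a x z : lam (a *: x) z = a * lam x z.
Proof. by case: hM => _ [[[_ /(_ z a x 0)]]]; rewrite !addr0 pol0l addr0. Qed.

Lemma pol_scaler a x z : lam x (a *: z) = a * lam x z.
Proof. by case: hM => _ [[[/(_ x a z 0)]]]; rewrite !addr0 pol0r addr0. Qed.

Lemma pol_alt x : lam x x = 0.
Proof. by case: hM => _ [[_ /(_ x)]]. Qed.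

Lemma pol_skew x y : lam x y = - lam y x.
Proof.
apply/eqP; rewrite -subr_eq0 opprK; have := pol_alt (x + y).
by rewrite pol_addl !pol_addr !pol_alt addr0 add0r => ->.
Qed.

Lemma pol_suml (I : Type) (r : seq I) (P : pred I) (x : I -> M) y :
  lam (\sum_(i <- r | P i) x i) y = \sum_(i <- r | P i) lam (x i) y.
Proof. by apply: (big_morph (lam^~ y)) => [u v|]; rewrite (pol_addl, pol0l). Qed.

Lemma pol_sumr (I : Type) (r : seq I) (P : pred I) x (y : I -> M) :
  lam x (\sum_(i <- r | P i) y i) = \sum_(i <- r | P i) lam x (y i).
Proof. by apply: (big_morph (lam x)) => [u v|]; rewrite (pol_addr, pol0r). Qed.

Lemma pol_nondeg x : (forall y, lam x y = 0) -> x = 0.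
Proof. by case: hM => _ [[_ _ /(_ x)]]. Qed.

Lemma FrD : {morph F : x y / x + y}.
Proof. by case: hM => [[[]]]. Qed.

Lemma FrZ a x : F (a *: x) = a ^+ p *: F x.
Proof. by case: hM => [[[_ ->]]]. Qed.

Lemma VeD : {morph V : x y / x + y}.
Proof. by case: hM => [[_ []]]. Qed.

Lemma VeZ a x : V (a *: x) = root_p p a *: V x.
Proof. by rewrite -{1}(root_pK hp a); case: hM => [[_ [_ ->]]]. Qed.

Lemma Fr_eq0 x : F x = 0 <-> exists y, x = V y.
Proof. by case: hM => [[]]. Qed.

Lemma Ve_eq0 x : V x = 0 <-> exists y, x = F y.
Proof. by case: hM => [[]]. Qed.

Lemma FrVe x : F (V x) = 0. Proof. by apply/Fr_eq0; exists x. Qed.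
Lemma VeFr x : V (F x) = 0. Proof. by apply/Ve_eq0; exists x. Qed.

Lemma pol_Frl x y : lam (F x) y = lam x (V y) ^+ p.
Proof. by case: hM => _ []. Qed.

Lemma pol_Frr x y : lam x (F y) = lam (V x) y ^+ p.
Proof.
rewrite pol_skew pol_Frl pol_skew.
by have := exp_pcharN hp 1; rewrite expn1 => ->; rewrite opprK.
Qed.

Lemma grade_disjoint e x : x \in G e -> x \in G (~~ e) -> x = 0.
Proof.
move=> xe xNe; apply/eqP; rewrite -memv0; case: hM => _ _ [_ <-] _ _.
by rewrite memv_cap; case: e xe xNe => -> ->.
Qed.

Lemma grade_decomp e x : exists y z, [/\ y \in G e, z \in G (~~ e) & x = y + z].
Proof.
have : x \in fullv by apply: memvf.
case: hM => _ _ [<- _] _ _ /memv_addP[y yG [z zG ->]].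
by case: e; [exists z, y; rewrite addrC | exists y, z].
Qed.

Lemma Fr_grade e x : x \in G e -> F x \in G (~~ e).
Proof. by case: hM => _ _ _ h _ /h[]. Qed.

Lemma Ve_grade e x : x \in G e -> V x \in G (~~ e).
Proof. by case: hM => _ _ _ h _ /h[]. Qed.

Lemma pol_grade e x y : x \in G e -> y \in G e -> lam x y = 0.
Proof. by case: hM => _ _ _ _ /(_ e x)[h _] /h; apply. Qed.

Lemma pol_nondeg_grade e x :
  x \in G e -> (forall y, y \in G (~~ e) -> lam x y = 0) -> x = 0.
Proof.
move=> xe h; apply: pol_nondeg => y; have [u [v [ue vNe ->]]] := grade_decomp e y.
by rewrite pol_addr (pol_grade xe ue) h // addr0.
Qed.

(** * Orthogonality between the two degrees *)

Definition pairing (U : {vspace M}) (y : M) : 'rV[k]_(\dim U) :=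
  \row_i lam (vbasis U)`_i y.

Lemma pairing_linear U : linear (@pairing U).
Proof. by move=> a x y; apply/rowP=> i; rewrite !mxE pol_addr pol_scaler. Qed.

HB.instance Definition _ U :=
  GRing.isLinear.Build k M 'rV[k]_(\dim U) *:%R (@pairing U) (@pairing_linear U).

Definition orth (U : {vspace M}) : {vspace M} := lker (linfun (@pairing U)).

Lemma mem_orth U y : y \in orth U <-> forall u, u \in U -> lam u y = 0.
Proof.
rewrite memv_ker lfunE /=; split=> [/eqP/rowP y0 u /coord_vbasis ->|y0].
  rewrite pol_suml big1 // => i _.
  by have := y0 i; rewrite !mxE pol_scalel => ->; rewrite mulr0.
by apply/eqP/rowP=> i; rewrite !mxE y0 // vbasis_mem // mem_nth ?size_tuple.
Qed.

Lemma dim_orth_geq U W : (\dim W <= \dim (W :&: orth U) + \dim U)%N.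
Proof.
rewrite -(limg_ker_dim (linfun (@pairing U)) W) leq_add2l.
by rewrite (leq_trans (dimvS (subvf _))) // dimvf /dim /= mul1n.
Qed.

(** As both degrees are Lagrangian, [lam] puts them in duality; for [U] of degree [e] this is the
    annihilator for that duality. *)
Definition perp e (U : {vspace M}) : {vspace M} := (G (~~ e) :&: orth U)%VS.

Lemma mem_perp e U y :
  y \in perp e U <-> y \in G (~~ e) /\ forall u, u \in U -> lam u y = 0.
Proof.
split=> [/memv_capP[yG /mem_orth y0] //|[yG y0]].
by apply/memv_capP; split=> //; apply/mem_orth.
Qed.

Lemma perp_sub e U : (perp e U <= G (~~ e))%VS.
Proof. exact: capvSl. Qed.

Lemma perpS e U W : (U <= W)%VS -> (perp e W <= perp e U)%VS.
Proof.
move=> /subvP sUW; apply/subvP=> y /mem_perp[yG y0]; apply/mem_perp; split=> // u /sUW.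
exact: y0.
Qed.

Lemma perp0 e : perp e 0 = G (~~ e).
Proof.
apply/vspaceP=> y; apply/idP/idP => [/mem_perp[] //|yG]; apply/mem_perp; split=> // u.
by rewrite memv0 => /eqP ->; rewrite pol0l.
Qed.

Lemma perp_grade e : perp e (G e) = 0%VS.
Proof.
apply/eqP; rewrite -subv0; apply/subvP=> y /mem_perp[yG y0]; rewrite memv0; apply/eqP.
apply: (pol_nondeg_grade yG) => u; rewrite negbK => uG.
by rewrite pol_skew y0 // oppr0.
Qed.

Lemma dim_perp_geq e U : (\dim (G (~~ e)) <= \dim (perp e U) + \dim U)%N.
Proof. exact: dim_orth_geq. Qed.

Lemma dim_grade e : \dim (G (~~ e)) = \dim (G e).
Proof.
suff le f : (\dim (G (~~ f)) <= \dim (G f))%N.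
  by apply/eqP; rewrite eqn_leq le -{1}(negbK e) le.
by have := dim_perp_geq f (G f); rewrite perp_grade dimv0.
Qed.

(** The lower bound holds for [U] and for a complement [W] of [U]. The annihilators of [U] and [W]
    meet in 0, so their dimensions add up to at most that of a degree, and both bounds are
    equalities. *)
Lemma dim_perp e U : (U <= G e)%VS -> (\dim (perp e U) + \dim U)%N = \dim (G e).
Proof.
move=> sUG; apply/eqP; rewrite eqn_leq -{2}(dim_grade e) dim_perp_geq andbT.
have [W [dimW capW]] : exists W, (\dim U + \dim W)%N = \dim (G e) /\ (U + W)%VS = G e.
  exists (G e :\: U)%VS; rewrite addvC addv_diff; split; last exact/addv_idPl.
  by rewrite -[RHS](dimv_cap_compl _ U); congr (\dim _ + _)%N; apply/esym/capv_idPr.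
have cap0 : (perp e U :&: perp e W)%VS = 0%VS.
  apply/eqP; rewrite -subv0 -(perp_grade e) -capW; apply/subvP=> y.
  case/memv_capP=> /mem_perp[yG yU] /mem_perp[_ yW]; apply/mem_perp; split=> // u.
  by case/memv_addP=> v vU [w wW ->]; rewrite pol_addl yU ?yW // addr0.
have := dimvS (perp_sub e U); rewrite -(leq_add2r (\dim (perp e W))).
have := dim_perp_geq e W.
have : (\dim (perp e U) + \dim (perp e W) <= \dim (G (~~ e)))%N.
  rewrite -dimv_disjoint_sum // dimvS // subv_add !perp_sub //.
rewrite dim_grade -dimW; lia.
Qed.

Lemma perpK e U : (U <= G e)%VS -> perp (~~ e) (perp e U) = U.
Proof.
move=> sUG; apply/esym/eqP; rewrite eqEdim; apply/andP; split.
  apply/subvP=> u uU; apply/mem_perp; rewrite negbK; split; first exact: (subvP sUG).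
  by move=> y /mem_perp[_ y0]; rewrite pol_skew y0 ?oppr0.
have := dim_perp (perp_sub e U); rewrite dim_grade -(dim_perp sUG); lia.
Qed.

(** * Images under [F] and preimages under [V] *)

Definition fim : {vspace M} -> {vspace M} := semilinear_image F.

Lemma mem_fim U y : y \in fim U <-> exists2 x, x \in U & y = F x.
Proof. exact: (mem_semilinear_image FrD FrZ (root_pK hp)). Qed.

Lemma fimS U W : (U <= W)%VS -> (fim U <= fim W)%VS.
Proof.
move=> /subvP sUW; apply/subvP=> _ /mem_fim[x /sUW Wx ->].
by apply/mem_fim; exists x.
Qed.

Lemma fim_sub e U : (U <= G e)%VS -> (fim U <= G (~~ e))%VS.
Proof. by move=> /subvP sUG; apply/subvP=> _ /mem_fim[x /sUG xG ->]; apply: Fr_grade. Qed.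

(* [V^-1(U)] in the complementary degree, for [U] of degree [e]. *)
Definition vpi e (U : {vspace M}) : {vspace M} := perp e (fim (perp e U)).

(** By adjunction, [y] is orthogonal to [F] of the annihilator of [U] exactly when [V y] is
    orthogonal to that annihilator. The detour in the definition pays off in that [perp] visibly
    exchanges [fim] and [vpi]. *)
Lemma mem_vpi e U y : (U <= G e)%VS -> y \in vpi e U <-> y \in G (~~ e) /\ V y \in U.
Proof.
move=> sUG; rewrite mem_perp -{2}(perpK sUG) mem_perp negbK.
split=> -[yG h]; split=> //; last first.
  move=> _ /mem_fim[x /(h.2) xV ->]; rewrite pol_Frl xV expr0n gtn_eqF //.
  by rewrite prime_gt0 // (pcharf_prime hp).
split; first by rewrite -[e]negbK; apply: Ve_grade.
move=> u uU; have := h (F u); rewrite pol_Frl => /(_ _)/eqP; rewrite expf_eq0.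
by case/(_ _)/andP => [|_ /eqP //]; apply/mem_fim; exists u.
Qed.

Lemma vpi_sub e U : (vpi e U <= G (~~ e))%VS.
Proof. exact: perp_sub. Qed.

Lemma vpiS e U W : (U <= W)%VS -> (vpi e U <= vpi e W)%VS.
Proof. by move=> sUW; apply/perpS/fimS/perpS. Qed.

Definition vim : {vspace M} -> {vspace M} := semilinear_image V.

Lemma mem_vim U y : y \in vim U <-> exists2 x, x \in U & y = V x.
Proof. exact: (mem_semilinear_image VeD VeZ (exp_pK hp)). Qed.

Lemma mem_vimf x : x \in vim fullv <-> F x = 0.
Proof.
by rewrite mem_vim Fr_eq0; split=> -[y]; exists y => //; rewrite memvf.
Qed.

Lemma mem_fimf x : x \in fim fullv <-> V x = 0.
Proof.
by rewrite mem_fim Ve_eq0; split=> -[y]; exists y => //; rewrite memvf.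
Qed.

Lemma vim_vpi e U : (U <= G e)%VS -> vim (vpi e U) = (U :&: vim fullv)%VS.
Proof.
move=> sUG; apply/vspaceP=> x; apply/idP/idP => [/mem_vim[y /(mem_vpi _ sUG)[yG Vy] ->]|].
  by rewrite memv_cap Vy; apply/mem_vim; exists y; rewrite ?memvf.
case/memv_capP=> xU /mem_vim[y _ xV]; have [u [v [uG vG yE]]] := grade_decomp e y.
have xv : x = V v.
  apply/eqP; rewrite -subr_eq0; apply/eqP; apply: (@grade_disjoint e).
    by rewrite memvB ?(subvP sUG _ xU) //; rewrite -[e]negbK; apply: Ve_grade.
  by rewrite xV yE VeD addrK; apply: Ve_grade.
by apply/mem_vim; exists v => //; apply/(mem_vpi _ sUG); rewrite -xv.
Qed.

Lemma expp0 : 0 ^+ p = 0 :> k.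
Proof. by rewrite expr0n gtn_eqF // prime_gt0 // (pcharf_prime hp). Qed.

(** [F] kills [U] intersected with [im V], which is exactly what [V] hits when applied to [V^-1(U)].
    The remaining term does not depend on [U], so between two subspaces of one degree the growths of
    [fim] and [vpi] add up to the growth of [U]. *)
Lemma dim_fim_vpi e U : (U <= G e)%VS ->
  (\dim (fim U) + \dim (vpi e U))%N = (\dim U + \dim (G (~~ e) :&: fim fullv))%N.
Proof.
move=> sUG.
rewrite -(dim_semilinear_image FrD FrZ expp0 (root_pK hp) U mem_vimf) -addnA.
congr (_ + _)%N; rewrite -(vim_vpi sUG).
rewrite -(dim_semilinear_image VeD VeZ (root_p0 hp) (exp_pK hp) (vpi e U) mem_fimf).
have -> // : (vpi e U :&: fim fullv = G (~~ e) :&: fim fullv)%VS.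
apply/vspaceP=> x; apply/idP/idP=> /memv_capP[h1 h2]; apply/memv_capP; split=> //.
  exact: (subvP (vpi_sub _ _) _ h1).
by apply/(mem_vpi _ sUG); rewrite ((mem_fimf _).1 h2) mem0v.
Qed.

(** The boolean is the degree. This is a graded version of the canonical filtration of a BT_1
    module; being a chain and being stable under [perp] are theorems about it. *)
Inductive canonical : bool -> {vspace M} -> Prop :=
| canonical0 e : canonical e 0%VS
| canonicalT e : canonical e (G e)
| canonicalF e U : canonical (~~ e) U -> canonical e (fim U)
| canonicalV e U : canonical (~~ e) U -> canonical e (vpi (~~ e) U).

Lemma canonical_sub e U : canonical e U -> (U <= G e)%VS.
Proof.
elim=> {e U} [e|e|e U _ sU|e U _ _]; rewrite ?sub0v ?subvv //.
  by rewrite -[e]negbK fim_sub.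
by rewrite -{2}[e]negbK vpi_sub.
Qed.

(** Since [V F = 0], every preimage under [V] contains every image under [F]; this settles the mixed
    cases in the comparison of canonical subspaces. *)
Lemma fim_sub_vpi e U W : (U <= G e)%VS -> (W <= G e)%VS -> (fim U <= vpi e W)%VS.
Proof.
move=> sU sW; apply/subvP=> _ /mem_fim[x xU ->]; apply/(mem_vpi _ sW).
by rewrite VeFr mem0v; split=> //; apply/Fr_grade/(subvP sU).
Qed.

Lemma canonical_total e U W : canonical e U -> canonical e W ->
  (U <= W)%VS \/ (W <= U)%VS.
Proof.
move=> cU; elim: cU W => {e U} [e|e|e U cU IH|e U cU IH] W cW.
- by left; rewrite sub0v.
- by right; apply: canonical_sub cW.
- case: cW cU IH => {e W} [e|e|e W cW|e W cW] cU IH.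
  + by right; rewrite sub0v.
  + by left; apply: (@canonical_sub e); apply: canonicalF.
  + by case: (IH _ cW) => h; [left | right]; apply: fimS.
  + by left; apply: fim_sub_vpi; apply: canonical_sub.
case: cW cU IH => {e W} [e|e|e W cW|e W cW] cU IH.
- by right; rewrite sub0v.
- by left; apply: (@canonical_sub e); apply: canonicalV.
- by right; apply: fim_sub_vpi; apply: canonical_sub.
by case: (IH _ cW) => h; [left | right]; apply: vpiS.
Qed.

Lemma canonical_perp e U : canonical e U -> canonical (~~ e) (perp e U).
Proof.
elim=> {e U} [e|e|e U cU IH|e U cU IH].
- by rewrite perp0; apply: canonicalT.
- by rewrite perp_grade; apply: canonical0.
- have UE := perpK (canonical_sub cU); rewrite negbK in UE; rewrite -UE.
  by have := @canonicalV (~~ e) _ IH; rewrite !negbK.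
rewrite negbK in IH; have := @perpK (~~ e) (fim (perp (~~ e) U)); rewrite negbK => ->.
  by apply: canonicalF; rewrite negbK.
by have := fim_sub (perp_sub (~~ e) U); rewrite negbK.
Qed.

(* The subquotient [high / low] of the canonical filtration in degree [deg]. *)
Definition block : Type := bool * ({vspace M} * {vspace M}).
Definition deg (b : block) := b.1.
Definition low (b : block) := b.2.1.
Definition high (b : block) := b.2.2.
(** The letter is f when [F] does not collapse the block; for blocks of least dimension the letter v
    then means that [V^-1] does not. *)
Definition blk_letter (b : block) : bool := fim (low b) != fim (high b).
Definition succ (b : block) : block :=
  (~~ deg b, if blk_letter b then (fim (low b), fim (high b))
             else (vpi (deg b) (low b), vpi (deg b) (high b))).
Definition dual_block (b : block) : block :=
  (~~ deg b, (perp (deg b) (high b), perp (deg b) (low b))).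

Lemma low_succ b :
  low (succ b) = if blk_letter b then fim (low b) else vpi (deg b) (low b).
Proof. by rewrite /succ; case: ifP. Qed.

Lemma high_succ b :
  high (succ b) = if blk_letter b then fim (high b) else vpi (deg b) (high b).
Proof. by rewrite /succ; case: ifP. Qed.

Section Blocks.
Variable d : nat.
Hypothesis d_gt0 : (0 < d)%N.
Hypothesis d_min : forall e A B, canonical e A -> canonical e B -> (A <= B)%VS ->
  A != B -> (\dim A + d <= \dim B)%N.

(* The blocks of least dimension [d]: such a block is not cut by [F] or
   [V^-1], and no canonical subspace lies strictly inside it. *)
Definition good (b : block) : Prop :=
  [/\ canonical (deg b) (low b), canonical (deg b) (high b), (low b <= high b)%VS
    & \dim (high b) = (\dim (low b) + d)%N].

Lemma good_canonical b U : good b -> canonical (deg b) U ->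
  (U <= low b)%VS \/ (high b <= U)%VS.
Proof.
move=> [cA cB sAB dimB] cU.
case: (canonical_total cU cA) => [|sAU]; first by left.
case: (canonical_total cU cB) => [sUB|]; last by right.
have [->|neU] := eqVneq (low b) U; first by left.
right; have [->|neB] := eqVneq U (high b); first exact: subvv.
have := d_min cU cB sUB neB; have := d_min cA cU sAU neU; lia.
Qed.

Lemma good_neq b : good b -> low b != high b.
Proof.
by case=> _ _ _ dimB; apply: contraTneq d_gt0 => eqAB; rewrite eqAB in dimB; lia.
Qed.

(** By [dim_fim_vpi] the growths of [fim] and [vpi] over the block sum to [d], and by [d_min] each
    is 0 or at least [d]; so one is 0 and the other is [d]. *)
Lemma good_succ_vpi b : good b -> blk_letter b = (vpi (deg b) (low b) == vpi (deg b) (high b))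
  /\ good (succ b).
Proof.
case: b => e [A B]; rewrite /good /succ /blk_letter /deg /low /high /= => -[cA cB sAB dimB].
have dA := dim_fim_vpi (canonical_sub cA); have dB := dim_fim_vpi (canonical_sub cB).
have cFA : canonical (~~ e) (fim A) by apply: canonicalF; rewrite negbK.
have cFB : canonical (~~ e) (fim B) by apply: canonicalF; rewrite negbK.
have cVA : canonical (~~ e) (vpi e A).
  by rewrite -{2}[e]negbK; apply: canonicalV; rewrite negbK.
have cVB : canonical (~~ e) (vpi e B).
  by rewrite -{2}[e]negbK; apply: canonicalV; rewrite negbK.
have sF := fimS sAB; have sV := vpiS e sAB.
have dF := dimvS sF; have dV := dimvS sV.
case: eqVneq => [eqF|neF] /=.
  split; last by rewrite eqF in dA; split=> //=; lia.
  by apply/esym/negP => /eqP eqV; rewrite eqF eqV in dA; lia.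
have hF := d_min cFA cFB sF neF.
split; last by split=> //=; lia.
by rewrite eqEdim sV /=; apply/esym; lia.
Qed.

Lemma good_succ b : good b -> good (succ b). Proof. by case/good_succ_vpi. Qed.

Lemma good_dual b : good b -> good (dual_block b).
Proof.
move=> [cA cB sAB dimB]; split; try exact: canonical_perp; first exact: perpS.
rewrite /low /high /=.
have := dim_perp (canonical_sub cA); have := dim_perp (canonical_sub cB); lia.
Qed.

Lemma dual_blockK b : good b -> dual_block (dual_block b) = b.
Proof.
case: b => e [A B] [/canonical_sub cA /canonical_sub cB _ _].
by rewrite /dual_block /low /high /deg /= !perpK // negbK.
Qed.

(** [perp] turns [fim] on the dual block into [vpi] on [b], and [vpi] moves exactly the blocks that
    [fim] collapses. *)
Lemma dual_letter b : good b -> blk_letter (dual_block b) = ~~ blk_letter b.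
Proof.
move=> gb; have gd := good_dual gb; rewrite (good_succ_vpi gb).1 /blk_letter.
case: b gb gd => e [A B] _ [cA cB _ _]; congr negb; rewrite /low /high /deg /=.
rewrite /vpi; apply/eqP/eqP => [->//|].
move/(congr1 (perp (~~ e))); rewrite !perpK //;
  by rewrite -{2}[e]negbK fim_sub // perp_sub.
Qed.

Lemma dual_succ b : good b -> dual_block (succ b) = succ (dual_block b).
Proof.
move=> gb; rewrite /succ dual_letter //; case: gb => /canonical_sub cA /canonical_sub cB _ _.
case: b cA cB => e [A B]; rewrite /deg /low /high /= => cA cB.
case: ifP => _; rewrite /dual_block /deg /low /high /= /vpi.
  by rewrite !perpK.
by rewrite !perpK //; rewrite -{2}[e]negbK fim_sub // perp_sub.
Qed.

Lemma good_iter n b : good b -> good (iter n succ b).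
Proof. by move=> gb; elim: n => //= n /good_succ. Qed.

Lemma deg_iter n b : deg (iter n succ b) = odd n (+) deg b.
Proof. by elim: n => //= n; rewrite /deg /= => ->; rewrite addNb. Qed.

Lemma dual_iter n b : good b -> dual_block (iter n succ b) = iter n succ (dual_block b).
Proof. by move=> gb; elim: n => //= n IHn; rewrite dual_succ ?IHn //; apply: good_iter. Qed.

Lemma iter_periodic m n b : iter m succ b = b -> iter (n %% m) succ b = iter n succ b.
Proof.
move=> per; rewrite {2}(divn_eq n m) addnC iterD; congr iter.
by elim: (n %/ m)%N => //= q IHq; rewrite mulSn iterD -IHq per.
Qed.

(** The index [i] is the same for all blocks of period [m], so two such blocks can be stepped back
    together. *)
Lemma iter_predecessor m j : (0 < m)%N ->
  exists i, forall b, iter m succ b = b -> iter j succ b = succ (iter i succ b).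
Proof.
move=> m_gt0; exists (j + m).-1 => b per.
by rewrite -iterS prednK ?addn_gt0 ?m_gt0 ?orbT // iterD per.
Qed.

Lemma good_nle b : good b -> ~~ (high b <= low b)%VS.
Proof.
move=> gb; have [_ _ sAB _] := gb; have := good_neq gb.
by apply: contra => sBA; rewrite eqEsubv sAB.
Qed.

(** Descent on the construction of [U]. If [U] is an [F]-image or a [V]-preimage lying between the
    two blocks, their common last letter must be of the same kind, since the other kind would
    collapse one of them by [fim_sub_vpi]. The subspace from which [U] was made then lies between
    the preceding blocks, and the process ends at 0 or at a whole degree, where it is absurd.
    Applied to [U = low b'], this shows that equal letters and degrees force equal blocks. *)
Lemma canonical_not_between b b' m : good b -> good b' -> deg b = deg b' -> (0 < m)%N ->
  iter m succ b = b -> iter m succ b' = b' ->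
  (forall j, blk_letter (iter j succ b) = blk_letter (iter j succ b')) ->
  forall e U, canonical e U -> forall j, deg (iter j succ b) = e ->
    ~ ((high (iter j succ b) <= U)%VS /\ (U <= low (iter j succ b'))%VS).
Proof.
move=> gb gb' eq_deg m_gt0 per per' eq_let e U.
elim=> {e U} [e|e|e U cU IH|e U cU IH] j deg_j [s1 s2].
- by have := good_nle (good_iter j gb); rewrite (subv_trans s1) ?sub0v.
- have := good_nle (good_iter j gb'); rewrite (subv_trans _ s2) // -deg_j.
  by rewrite deg_iter eq_deg -deg_iter canonical_sub //; case: (good_iter j gb').
- have [i step] := iter_predecessor j m_gt0.
  have gi := good_iter i gb; have gi' := good_iter i gb'.
  have deg_i : deg (iter i succ b) = ~~ e by rewrite -deg_j (step _ per) negbK.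
  have deg_i' : deg (iter i succ b') = ~~ e by rewrite -deg_i !deg_iter eq_deg.
  rewrite (step _ per) in s1; rewrite (step _ per') in s2.
  have n := good_nle (good_succ gi); have n' := good_nle (good_succ gi').
  have cA : (low (iter i succ b) <= G (~~ e))%VS.
    by rewrite -deg_i canonical_sub //; case: gi.
  rewrite high_succ deg_i in s1; rewrite low_succ -eq_let deg_i' in s2.
  rewrite low_succ high_succ deg_i in n; rewrite low_succ high_succ -eq_let deg_i' in n'.
  case: (blk_letter _) s1 s2 n n' => s1 s2 n n'; last first.
    have sF : (fim U <= vpi (~~ e) (low (iter i succ b)))%VS.
      by rewrite fim_sub_vpi // canonical_sub.
    by rewrite (subv_trans s1 sF) in n.
  rewrite -deg_i in cU; have [sU|sU] := good_canonical gi cU.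
    by rewrite (subv_trans s1 (fimS sU)) in n.
  rewrite deg_i -deg_i' in cU; have [sU'|sU'] := good_canonical gi' cU.
    exact: (IH i deg_i).
  by rewrite (subv_trans (fimS sU') s2) in n'.
have [i step] := iter_predecessor j m_gt0.
have gi := good_iter i gb; have gi' := good_iter i gb'.
have deg_i : deg (iter i succ b) = ~~ e by rewrite -deg_j (step _ per) negbK.
have deg_i' : deg (iter i succ b') = ~~ e by rewrite -deg_i !deg_iter eq_deg.
rewrite (step _ per) in s1; rewrite (step _ per') in s2.
have n := good_nle (good_succ gi); have n' := good_nle (good_succ gi').
have cB : (high (iter i succ b') <= G (~~ e))%VS.
  by rewrite -deg_i' canonical_sub //; case: gi'.
rewrite high_succ deg_i in s1; rewrite low_succ -eq_let deg_i' in s2.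
rewrite low_succ high_succ deg_i in n; rewrite low_succ high_succ -eq_let deg_i' in n'.
case: (blk_letter _) s1 s2 n n' => s1 s2 n n'.
  have sF : (fim (high (iter i succ b')) <= vpi (~~ e) U)%VS.
    by rewrite fim_sub_vpi // canonical_sub.
  by rewrite (subv_trans sF s2) in n'.
rewrite -deg_i in cU; have [sU|sU] := good_canonical gi cU.
  by rewrite (subv_trans s1 (vpiS _ sU)) in n.
rewrite deg_i -deg_i' in cU; have [sU'|sU'] := good_canonical gi' cU.
  exact: (IH i deg_i).
by rewrite (subv_trans (vpiS _ sU') s2) in n'.
Qed.

Lemma periodic_not_above b b' m : good b -> good b' -> deg b = deg b' -> (0 < m)%N ->
  iter m succ b = b -> iter m succ b' = b' ->
  (forall j, blk_letter (iter j succ b) = blk_letter (iter j succ b')) ->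
  ~~ (high b <= low b')%VS.
Proof.
move=> gb gb' eq_deg m_gt0 per per' eq_let; apply/negP => sBA.
have [cA' _ _ _] := gb'; rewrite -eq_deg in cA'.
exact: (canonical_not_between gb gb' eq_deg m_gt0 per per' eq_let cA' (j := 0)).
Qed.

Lemma good_trichotomy b b' : good b -> good b' -> deg b = deg b' ->
  [\/ b = b', (high b <= low b')%VS | (high b' <= low b)%VS].
Proof.
move=> gb gb' eq_deg; have [cA cB sAB dimB] := gb; have [cA' cB' sAB' dimB'] := gb'.
have cA2 := cA; rewrite eq_deg in cA2; have cA'2 := cA'; rewrite -eq_deg in cA'2.
have [sA'|?] := good_canonical gb cA'2; last exact: Or32.
have [sA|?] := good_canonical gb' cA2; last exact: Or33.
have eqA : low b = low b' by apply/eqP; rewrite eqEsubv sA sA'.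
rewrite -eq_deg in cB'; have [sB|sB] := good_canonical gb cB'.
  by apply: Or33.
apply: Or31; case: b b' eqA eq_deg sB dimB dimB' {gb gb' cA cB cA' cB' sAB sAB' cA2 cA'2 sA sA'}
  => e [A B] [e' [A' B']]; rewrite /low /high /deg /= => -> -> sB dimB dimB'.
by congr (_, (_, _)); apply/eqP; rewrite eqEdim sB; lia.
Qed.

Lemma periodic_block_unique b b' m : good b -> good b' -> deg b = deg b' -> (0 < m)%N ->
  iter m succ b = b -> iter m succ b' = b' ->
  (forall j, (j < m)%N -> blk_letter (iter j succ b) = blk_letter (iter j succ b')) ->
  b = b'.
Proof.
move=> gb gb' eq_deg m_gt0 per per' eq_lt.
have eq_let j : blk_letter (iter j succ b) = blk_letter (iter j succ b').
  by rewrite -(iter_periodic _ per) -(iter_periodic _ per') eq_lt ?ltn_mod.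
case: (good_trichotomy gb gb' eq_deg) => // s.
  by have := periodic_not_above gb gb' eq_deg m_gt0 per per' eq_let; rewrite s.
have eq_let' j : blk_letter (iter j succ b') = blk_letter (iter j succ b) by [].
by have := periodic_not_above gb' gb (esym eq_deg) m_gt0 per' per eq_let'; rewrite s.
Qed.

Lemma periodic_block b : good b -> exists b' m, [/\ good b', deg b' = false, (0 < m)%N,
  iter m succ b' = b' & forall j, (0 < j < m)%N -> iter j succ b' != b'].
Proof.
move=> gb.
have [i [j [lt_ij eq_ij]]] : exists i j, (i < j)%N /\ iter i succ b = iter j succ b.
  pose N := (\dim {:M}).+1.
  (* Pigeonhole: by [good_trichotomy], a good block is determined by its degree and the dimension of
     its lower space. *)
  pose f (i : 'I_(2 * N).+1) : bool * 'I_N :=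
    (deg (iter i succ b), inord (\dim (low (iter i succ b)))).
  have /injectivePn[i [j neq_ij [eq_deg]]] : ~~ injectiveb f.
    apply/negP => /injectiveP/leq_card; rewrite card_prod card_bool !card_ord.
    by rewrite ltnn.
  have dim_lt (U : {vspace M}) : (\dim U < N)%N by rewrite /N ltnS dimvS // subvf.
  move/(congr1 val); rewrite /= !inordK // => eq_dim.
  have eq_b : iter i succ b = iter j succ b.
    have gi := good_iter i gb; have gj := good_iter j gb.
    have [_ _ _ dimi] := gi; have [_ _ _ dimj] := gj.
    by case: (good_trichotomy gi gj eq_deg) => // /dimvS; lia.
  have [lt|lt|/val_inj eq] := ltngtP i j; [by exists i, j | by exists j, i |].
  by rewrite eq eqxx in neq_ij.
have perS n : iter (j - i) succ (iter (n + i) succ b) = iter (n + i) succ b.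
  by rewrite -iterD addnCA subnK ?(ltnW lt_ij) // iterD -eq_ij -iterD.
have [b1 [g1 d1 per1]] : exists b1, [/\ good b1, deg b1 = false &
    iter (j - i) succ b1 = b1].
  (* The degree, read as 0 or 1, adds one step exactly when it is [true]. *)
  exists (iter (deg (iter i succ b) + i) succ b); split=> //; first exact: good_iter.
  by rewrite iterD deg_iter; case: (deg _).
have exm : exists m, (0 < m)%N && (iter m succ b1 == b1).
  by exists (j - i)%N; rewrite subn_gt0 lt_ij per1 eqxx.
case: (ex_minnP exm) => m /andP[m_gt0 /eqP per] m_min; exists b1, m; split=> // l.
case/andP=> l_gt0 lt_lm; apply: contraTneq lt_lm => perl.
by rewrite -leqNgt m_min // l_gt0 perl eqxx.
Qed.

(** * Chains of vectors through successive blocks *)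

Implicit Types (b : block).

Lemma low_grade b : good b -> (low b <= G (deg b))%VS.
Proof. by case=> cA _ _ _; exact: canonical_sub cA. Qed.

Lemma high_grade b : good b -> (high b <= G (deg b))%VS.
Proof. by case=> _ cB _ _; exact: canonical_sub cB. Qed.

(** An edge between consecutive basis vectors of a word module: forward by [F] for f, backward by
    [V] for v. *)
Definition link (u : bool) (x x' : M) : Prop := if u then F x = x' else V x' = x.

Lemma link_pol u x x' y y' : link u x x' -> link (~~ u) y y' ->
  lam x' y' = lam x y ^+ p.
Proof. by case: u => /= [<- <- | <- <-]; rewrite (pol_Frl, pol_Frr). Qed.

Lemma linkD u x x' y y' : link u x x' -> link u y y' -> link u (x + y) (x' + y').
Proof. by case: u => /= <- <-; rewrite ?FrD ?VeD. Qed.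

Lemma linkZ u a x x' : link u x x' -> link u (a *: x) (a ^+ p *: x').
Proof. by case: u => /= <-; rewrite ?FrZ // VeZ (exp_pK hp). Qed.

Lemma link_seq_pol n (u : nat -> bool) (x y : nat -> M) :
  (forall j, (j < n)%N -> link (u j) (x j) (x j.+1)) ->
  (forall j, (j < n)%N -> link (~~ u j) (y j) (y j.+1)) ->
  lam (x n) (y n) = lam (x 0) (y 0) ^+ (p ^ n).
Proof.
elim: n => [|n IHn] hx hy; first by rewrite expr1.
rewrite (link_pol (hx n _) (hy n _)) // IHn => [|j lt|j lt]; rewrite ?expnSr ?exprM //.
  by apply: hx; rewrite ltnS ltnW.
by apply: hy; rewrite ltnS ltnW.
Qed.

(** For the letter f this is injectivity of [F] modulo [low b]. As [V^-1] collapses the block,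
    [low b] and [high b] have the same intersection with [im V = ker F], so two vectors of [high b]
    with the same image differ by an element of [low b]. *)
Lemma link_low b x x' : good b -> x \in high b -> x' \in high (succ b) ->
  link (blk_letter b) x x' -> (x \in low b) = (x' \in low (succ b)).
Proof.
move=> gb; have [let_vpi gs] := good_succ_vpi gb.
have sA := low_grade gb; have sB := high_grade gb.
rewrite low_succ high_succ; move: let_vpi; rewrite /link.
case: (blk_letter b) => [/esym/eqP eq_vpi|_] xB xB' /=; last first.
  move=> Vx'; have /(mem_vpi _ sB)[x'G _] := xB'.
  by apply/idP/idP => [xA|/(mem_vpi _ sA)[]]; [apply/(mem_vpi _ sA); rewrite Vx'|rewrite Vx'].
move=> Fx; apply/idP/idP => [xA|/mem_fim[a aA aF]].
  by apply/mem_fim; exists x.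
rewrite -(subrK a x) memvD //.
have : x - a \in (high b :&: vim fullv)%VS.
  apply/memv_capP; split; first by rewrite memvB //; case: gb => _ _ /subvP s _; apply: s.
  by apply/mem_vimf; rewrite (semilinearB FrD) Fx aF subrr.
by rewrite -(vim_vpi sB) -eq_vpi (vim_vpi sA) => /memv_capP[].
Qed.

Lemma back_step b : good b -> exists S : M -> M,
  [/\ {morph S : x y / x + y}, forall a x, S (a ^+ p *: x) = a *: S x
    & forall y, y \in high (succ b) -> S y \in high b /\ link (blk_letter b) (S y) y].
Proof.
move=> gb; rewrite high_succ /link; case: (blk_letter b); last first.
  exists V; split=> [||y /(mem_vpi _ (high_grade gb))[] //].
    exact: VeD.
  by move=> a x; rewrite VeZ (exp_pK hp).
have [S [SD SZ SP]] := semilinear_section FrD FrZ (root_pK hp)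
  (high b) (root_pD hp) (root_pM hp).
by exists S; split=> // a x; rewrite SZ (exp_pK hp).
Qed.

(** [X j y] is the vector at position [j] of the chain that ends at [y], and [X 0] is the full
    backward turn, to which [fixed_vector] will apply. *)
Lemma back_chain m b : good b -> exists X : nat -> M -> M,
  [/\ {morph X 0 : x y / x + y}, forall a x, X 0 (a ^+ (p ^ m) *: x) = a *: X 0 x
    & forall y, y \in high (iter m succ b) ->
      [/\ X m y = y, forall j, (j <= m)%N -> X j y \in high (iter j succ b)
        & forall j, (j < m)%N ->
            link (blk_letter (iter j succ b)) (X j y) (X j.+1 y)]].
Proof.
elim: m b => [|m IHm] b gb.
  exists (fun _ x => x); split=> [//|a x|y yB]; first by rewrite expr1.
  by split=> // -[|j].
have [X [XD XZ XP]] := IHm _ (good_succ gb).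
have [S [SD SZ SP]] := back_step gb.
exists (fun j y => if j is i.+1 then X i y else S (X 0 y)); split=> [x y|a x|y yB].
- by rewrite XD SD.
- by rewrite expnS exprM XZ SZ.
rewrite iterSr in yB; have [Xm XB Xlink] := XP y yB.
have [SB Slink] := SP _ (XB 0 isT).
by split=> // -[|j] lt //; rewrite iterSr; [apply: XB|apply: Xlink].
Qed.

Definition chain m b (x : nat -> M) : Prop :=
  [/\ forall j, x j \in high (iter j succ b),
      forall j, link (blk_letter (iter j succ b)) (x j) (x j.+1)
    & forall j, x (j + m)%N = x j].

(** [A] is left free for two uses: [low b], and the hyperplane orthogonal to a vector of a given
    chain. *)
Lemma chain_exists m b (A : {vspace M}) : good b -> (0 < m)%N ->
  iter m succ b = b -> (A <= high b)%VS -> A != high b ->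
  (forall x : nat -> M, (forall j, (j <= m)%N -> x j \in high (iter j succ b)) ->
    (forall j, (j < m)%N -> link (blk_letter (iter j succ b)) (x j) (x j.+1)) ->
    (x 0 \in A) = (x m \in A)) ->
  exists x, chain m b x /\ x 0 \notin A.
Proof.
move=> gb m_gt0 per sAB neAB stabA; have [X [XD XZ XP]] := back_chain m gb.
rewrite per in XP.
have [|y yB|y [yB yA Xy]] := fixed_vector hp m_gt0 XD XZ sAB neAB.
- by move=> y /XP[_ XB _]; apply: (XB 0).
- by have [Xm XB Xl] := XP y yB; rewrite -{2}Xm (stabA (X^~ y)).
have [Xm XB Xl] := XP y yB.
(* The chain closes up at the seam because [X m y = y = X 0 y]. *)
exists (fun j => X (j %% m)%N y); split; last by rewrite mod0n Xy.
have perj j := iter_periodic j per.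
split=> j; last by rewrite modnDr.
  by rewrite -perj XB // ltnW // ltn_mod.
have := Xl (j %% m)%N; rewrite perj ltn_mod m_gt0 modnS => /(_ isT).
case: ifP => // dv; suff -> : (j %% m).+1%N = m by rewrite Xm Xy.
have [lt|] := ltnP (j %% m).+1%N m; last by have := ltn_pmod j m_gt0; lia.
by move: dv; rewrite /dvdn -addn1 -modnDml addn1 modn_small.
Qed.

Lemma chain_exists_low m b : good b -> (0 < m)%N -> iter m succ b = b ->
  exists x, chain m b x /\ x 0 \notin low b.
Proof.
move=> gb m_gt0 per; have [_ _ sAB _] := gb.
apply: chain_exists => // [|x xB xl]; first exact: good_neq gb.
have H j : (j <= m)%N -> (x 0 \in low b) = (x j \in low (iter j succ b)).
  elim: j => // j IHj lt_jm; rewrite IHj ?(ltnW lt_jm) //.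
  apply: link_low (xl _ lt_jm); [exact: good_iter | exact/xB/ltnW | exact: xB].
by rewrite (H m) // per.
Qed.

Lemma chain_pol m m' b (x y : nat -> M) j : good b -> chain m b x -> chain m' (dual_block b) y ->
  lam (x j) (y j) = lam (x 0) (y 0) ^+ (p ^ j).
Proof.
move=> gb [_ xl _] [_ yl _]; apply: link_seq_pol => i _; first exact: xl.
by rewrite -dual_letter ?dual_iter //; apply: good_iter.
Qed.

(** Take for [A] the vectors of the dual block orthogonal to [x 0]. It is a proper subspace, since
    [x 0] would otherwise lie in the annihilator [low b]. It respects the two ends of a chain
    because one turn raises the pairing to the power [p ^ m] and [x m = x 0]. *)
Lemma dual_chain m b (x : nat -> M) : good b -> (0 < m)%N -> iter m succ b = b ->
  chain m b x -> x 0 \notin low b ->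
  exists y, chain m (dual_block b) y /\ lam (x 0) (y 0) != 0.
Proof.
move=> gb m_gt0 per [xB xl xper] x0.
have gd := good_dual gb.
have perd : iter m succ (dual_block b) = dual_block b.
  by rewrite -dual_iter // per.
have inH y : y \in high (dual_block b) -> (y \in perp (deg b) <[x 0%N]>%VS) = (lam (x 0) y == 0).
  move/(subvP (high_grade gd)) => yG; apply/idP/eqP => [/mem_perp[_ -> //]|y0].
    exact: memv_line.
  apply/mem_perp; split=> // u /vlineP[a ->].
  by rewrite pol_scalel y0 mulr0.
have inH' y : y \in high (dual_block b) ->
    (y \in high (dual_block b) :&: perp (deg b) <[x 0%N]>)%VS = (lam (x 0) y == 0).
  by move=> yB; rewrite memv_cap yB inH.
have [|||y [cy y0]] :=
  @chain_exists m _ (high (dual_block b) :&: perp (deg b) <[x 0%N]>)%VS gd m_gt0 perd.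
- exact: capvSl.
- apply: contraNneq x0 => capE; rewrite -(perpK (low_grade gb)); apply/mem_perp.
  rewrite negbK; split; first exact/(subvP (high_grade gb))/(xB 0).
  move=> u uH; have : u \in high (dual_block b) by [].
  by rewrite -{1}capE inH' // => /eqP u0; rewrite pol_skew u0 oppr0.
- move=> y yB yl; have y0B : y 0 \in high (dual_block b) := yB 0%N isT.
  have ymB : y m \in high (dual_block b) by rewrite -perd yB.
  rewrite !inH' //.
  have -> : lam (x 0) (y m) = lam (x m) (y m) by rewrite -(xper 0).
  rewrite (@link_seq_pol m (fun j => blk_letter (iter j succ b))) //.
    by rewrite expf_eq0 expn_gt0 prime_gt0 // (pcharf_prime hp).
  move=> j lt; rewrite -dual_letter ?dual_iter //; last exact: good_iter.
  exact: yl.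
exists y; split=> //; apply: contraNneq y0 => y0.
have y0B : y 0 \in high (dual_block b) by case: cy => /(_ 0).
by rewrite inH' // y0.
Qed.

Lemma chainD m b (x y : nat -> M) : chain m b x -> chain m b y -> chain m b (fun j => x j + y j).
Proof.
move=> [xB xl xper] [yB yl yper]; split=> j; rewrite ?memvD ?xper ?yper //.
exact: linkD.
Qed.

Lemma chainZ m b a (x : nat -> M) : a ^+ (p ^ m) = a -> chain m b x ->
  chain m b (fun j => a ^+ (p ^ j) *: x j).
Proof.
move=> am [xB xl xper]; split=> j.
- by rewrite memvZ.
- by rewrite expnSr exprM; apply: linkZ.
by rewrite xper expnD mulnC exprM am.
Qed.

Lemma chain_shift m b n (x : nat -> M) : chain m b x ->
  chain m (iter n succ b) (fun j => x (j + n)%N).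
Proof.
move=> [xB xl xper]; split=> j.
- by rewrite -iterD xB.
- by rewrite -iterD; apply: xl.
by rewrite addnAC xper.
Qed.

(** If [b'] lay strictly below the dual block of [b], it would be inside the annihilator of
    [high b]. So [b'] is that dual block or lies above it, and dualizing gives the dimension
    inequality, the source of the triangular Gram matrices. *)
Lemma block_pol b b' x y : good b -> good b' -> x \in high b -> y \in high b' ->
  lam x y != 0 ->
  b' = dual_block b \/ (\dim (low (dual_block b')) < \dim (low b))%N.
Proof.
move=> gb gb' xB yB xy0; have gd := good_dual gb.
have xG := subvP (high_grade gb) _ xB; have yG := subvP (high_grade gb') _ yB.
have eq_deg : deg b' = deg (dual_block b).
  rewrite -[RHS]/(~~ deg b); have [eqd|] := eqVneq (deg b') (deg b).
    by rewrite (pol_grade xG) ?eqxx // -eqd in xy0.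
  by case: (deg b) (deg b') => -[].
have [|s|s] := good_trichotomy gb' gd eq_deg; first by left.
  have /mem_perp[_ y0] := subvP s _ yB.
  by rewrite (y0 x xB) eqxx in xy0.
right; have [_ _ _ dimE] := good_dual gb'.
have h : (high (dual_block b') <= low b)%VS.
  rewrite -(perpK (low_grade gb)) /high /= eq_deg /deg /=.
  exact: perpS.
by rewrite (leq_trans _ (dimvS h)) // dimE -addn1 leq_add2l.
Qed.

End Blocks.

Lemma minimal_blocks : nonzero M -> exists2 d, (0 < d)%N &
  (forall e A B, canonical e A -> canonical e B -> (A <= B)%VS ->
    A != B -> (\dim A + d <= \dim B)%N) /\ exists b, good d b.
Proof.
case=> x x0.
pose P d := (0 < d)%N /\ exists b, good d b.
have [d Pd] : exists d, P d.
  have [e Ge] : exists e, G e != 0%VS.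
    have [y [z [yG zG xE]]] := grade_decomp false x.
    have [y0|y0] := eqVneq y 0; last first.
      by exists false; apply: contraNneq y0 => G0; rewrite -memv0 -G0.
    exists true; apply: contraNneq x0 => G0; rewrite xE y0 add0r -memv0 -G0 //.
  exists (\dim (G e)); split; first by rewrite lt0n dimv_eq0.
  exists (e, (0%VS, G e)); split; rewrite /deg /low /high /=.
  - exact: canonical0.
  - exact: canonicalT.
  - exact: sub0v.
  by rewrite dimv0.
elim/ltn_ind: d Pd => d IH [d_gt0 [b gb]].
case: (classic (exists2 d', (d' < d)%N & P d')) => [[d' lt /(IH _ lt)] //|min].
exists d => //; split; last by exists b.
move=> e A B cA cB sAB neAB; rewrite leqNgt; apply/negP => lt; apply: min.
have leAB := dimvS sAB.
exists (\dim B - \dim A)%N; first by lia.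
split; last by exists (e, (A, B)); split=> //=; rewrite /low /high /=; lia.
by move: neAB; rewrite eqEdim sAB /=; lia.
Qed.

End UnitaryTheory.

(** * Orthogonal summands and frames *)

(** Maps are built from the model to [M], and [psi] need only send each degree into the same degree:
    the converse follows because [N] is the sum of its degrees while those of [M] meet in 0. *)
Lemma unitary_iso_inverse (k : fieldType) (M N : unitary_data k) (psi : {linear N -> M}) :
  injective psi -> (forall y, exists x, psi x = y) ->
  (forall x, psi (Fr x) = Fr (psi x)) -> (forall x, psi (Ve x) = Ve (psi x)) ->
  (forall x y, pol (psi x) (psi y) = pol x y) ->
  (forall e x, x \in grade N e -> psi x \in grade M e) ->
  (forall x : N, exists y z, [/\ y \in grade N false, z \in grade N true & x = y + z]) ->
  (grade M false :&: grade M true = 0)%VS ->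
  unitary_iso M N.
Proof.
move=> psi_inj psi_surj psiF psiV psi_pol psi_grade decN disjM.
have ker0 : lker (linfun psi) == 0%VS.
  by apply/lker0P => x y; rewrite !lfunE; apply: psi_inj.
pose phi : {linear M -> N} := ((linfun psi)^-1)%VF.
have phiK : cancel psi phi by move=> x; rewrite -[psi x](lfunE psi) /phi /= lker0_lfunK.
have psiK : cancel phi psi by move=> y; have [x <-] := psi_surj y; rewrite phiK.
exists phi; split.
- by exists psi.
- by move=> x; apply: psi_inj; rewrite psiK psiF psiK.
- by move=> x; apply: psi_inj; rewrite psiK psiV psiK.
- by move=> x y; rewrite -psi_pol !psiK.
move=> e x; apply/idP/idP => [/psi_grade|]; rewrite ?psiK // => xe.
have [y [z [y0 z1 xE]]] := decN (phi x).
have psiE : psi y + psi z = x by rewrite -linearD -xE psiK.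
have disj w : w \in grade M false -> w \in grade M true -> w = 0.
  by move=> w0 w1; apply/eqP; rewrite -memv0 -disjM memv_cap w0.
case: e xe => xe.
  suff y_eq0 : y = 0 by rewrite xE y_eq0 add0r.
  apply: psi_inj; rewrite linear0; apply: disj; first exact: psi_grade.
  by rewrite -(addrK (psi z) (psi y)) psiE memvB // psi_grade.
suff z_eq0 : z = 0 by rewrite xE z_eq0 addr0.
apply: psi_inj; rewrite linear0; apply: disj; last exact: psi_grade.
by rewrite -(addKr (psi y) (psi z)) psiE addrC memvB // psi_grade.
Qed.

Section Summands.
Variables (k : closedFieldType) (p : nat).
Hypothesis hp : p \in [pchar k].
Variable M : unitary_data k.
Hypothesis hM : is_unitary_BT1 p M.
Local Notation F := (@Fr k M).
Local Notation V := (@Ve k M).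
Local Notation lam := (@pol k M).
Local Notation G := (grade M).

Record graded_submodule (U : {vspace M}) : Prop := GradedSubmodule {
  sub_Fr : forall x, x \in U -> F x \in U;
  sub_Ve : forall x, x \in U -> V x \in U;
  sub_graded : forall x, x \in U ->
    exists y z, [/\ y \in U, y \in G false, z \in U, z \in G true & x = y + z] }.

Lemma graded_decomp i U x : graded_submodule U -> x \in U ->
  exists y z, [/\ y \in U, y \in G i, z \in U, z \in G (~~ i) & x = y + z].
Proof.
move=> sU /(sub_graded sU)[y [z [yU y0 zU z1 xE]]].
by case: i; [exists z, y; rewrite addrC | exists y, z].
Qed.

(** [vsproj] makes [F] and [V] total for arbitrary [U]; on a graded submodule it changes nothing. *)
Definition restriction (U : {vspace M}) : unitary_data k :=
  @UnitaryData k
    (@BT1Data k (subvs_of U) (fun x => vsproj U (F (vsval x)))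
      (fun x => vsproj U (V (vsval x))))
    (fun x y => lam (vsval x) (vsval y))
    (fun e => (linfun (vsval : subvs_of U -> M) @^-1: G e)%VS).

Lemma mem_grade_restriction U e (x : restriction U) :
  (x \in grade (restriction U) e) = (vsval x \in G e).
Proof. by rewrite -memv_preim lfunE. Qed.

Lemma vsval_Fr U (x : restriction U) : graded_submodule U ->
  vsval (Fr x) = F (vsval x).
Proof. by move=> sU; rewrite vsprojK //; apply/sub_Fr/subvsP. Qed.

Lemma vsval_Ve U (x : restriction U) : graded_submodule U ->
  vsval (Ve x) = V (vsval x).
Proof. by move=> sU; rewrite vsprojK //; apply/sub_Ve/subvsP. Qed.

(** The complement serves for exactness: if [x] in [U] is [V w], the [U']-component of [w] is killed
    by [V], so [x] is already [V] of the [U]-component; the same holds for [F]. *)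
Lemma restriction_unitary (U U' : {vspace M}) :
  graded_submodule U -> graded_submodule U' -> (U + U' = fullv)%VS ->
  (U :&: U' = 0)%VS -> (forall x y, x \in U -> y \in U' -> lam x y = 0) ->
  is_unitary_BT1 p (restriction U).
Proof.
move=> sU sU' dec disj orth.
have decP x : exists y z, [/\ y \in U, z \in U' & x = y + z].
  have : x \in (U + U')%VS by rewrite dec memvf.
  by case/memv_addP=> y yU [z zU' ->]; exists y, z.
have eq0 x : x \in U -> x \in U' -> x = 0.
  by move=> xU xU'; apply/eqP; rewrite -memv0 -disj memv_cap xU.
have vsvalD (x y : restriction U) : vsval (x + y) = vsval x + vsval y by rewrite linearD.
have vsvalZ a (x : restriction U) : vsval (a *: x) = a *: vsval x by rewrite linearZ.
have vsval0 : vsval (0 : restriction U) = 0 by rewrite linear0.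
split.
- split.
  + split=> [x y|a x]; apply: subvs_inj.
      by rewrite vsvalD !vsval_Fr // vsvalD (FrD hM).
    by rewrite vsvalZ !vsval_Fr // vsvalZ (FrZ hM).
  + split=> [x y|a x]; apply: subvs_inj.
      by rewrite vsvalD !vsval_Ve // vsvalD (VeD hM).
    by rewrite vsvalZ !vsval_Ve // vsvalZ (VeZ hp hM) exp_pK.
  + move=> x; split=> [Fx0|[y ->]]; last first.
      by apply: subvs_inj; rewrite vsval0 !(vsval_Fr, vsval_Ve) // (FrVe hM).
    have /(Fr_eq0 hM)[w xV] : F (vsval x) = 0 by rewrite -vsval_Fr // Fx0 vsval0.
    have [y [z [yU zU wE]]] := decP w; rewrite wE (VeD hM) in xV.
    have z0 : V z = 0.
      apply: eq0; last exact: sub_Ve.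
      by rewrite -(addKr (V y) (V z)) -xV memvD ?memvN ?sub_Ve ?subvsP.
    by exists (vsproj U y); apply: subvs_inj; rewrite vsval_Ve // vsprojK // xV z0 addr0.
  move=> x; split=> [Vx0|[y ->]]; last first.
    by apply: subvs_inj; rewrite vsval0 !(vsval_Fr, vsval_Ve) // (VeFr hM).
  have /(Ve_eq0 hM)[w xF] : V (vsval x) = 0 by rewrite -vsval_Ve // Vx0 vsval0.
  have [y [z [yU zU wE]]] := decP w; rewrite wE (FrD hM) in xF.
  have z0 : F z = 0.
    apply: eq0; last exact: sub_Fr.
    by rewrite -(addKr (F y) (F z)) -xF memvD ?memvN ?sub_Fr ?subvsP.
  by exists (vsproj U y); apply: subvs_inj; rewrite vsval_Fr // vsprojK // xF z0 addr0.
- split; first split; first split.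
  + by move=> x a y z; rewrite /= (pol_addr hM) (pol_scaler hM).
  + by move=> z a x y; rewrite /= (pol_addl hM) (pol_scalel hM).
  + by move=> x; apply: (pol_alt hM).
  + move=> x x0; apply: subvs_inj; rewrite vsval0; apply: (pol_nondeg hM) => w.
    have [y [z [yU zU' ->]]] := decP w; rewrite (pol_addr hM) [lam _ z]orth ?subvsP // addr0.
    by have := x0 (vsproj U y); rewrite /= vsprojK.
  by move=> x y; rewrite /= !vsprojK ?sub_Fr ?sub_Ve ?subvsP // (pol_Frl hM).
- split.
    apply/eqP; rewrite eqEsubv subvf; apply/subvP=> x _.
    have [y [z [yU y0 zU z1 xE]]] := sub_graded sU (subvsP x).
    apply/memv_addP; exists (vsproj U y); first by rewrite mem_grade_restriction vsprojK.
    exists (vsproj U z); first by rewrite mem_grade_restriction vsprojK.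
    by apply: subvs_inj; rewrite vsvalD !vsprojK.
  apply/eqP; rewrite -subv0; apply/subvP=> x /memv_capP[].
  rewrite !mem_grade_restriction => x0 x1; rewrite memv0; apply/eqP/subvs_inj.
  by rewrite vsval0; apply: (@grade_disjoint _ _ _ hM false).
- move=> i x; rewrite !mem_grade_restriction => xi; split.
    by rewrite vsval_Fr //; apply: (Fr_grade hM).
  by rewrite vsval_Ve //; apply: (Ve_grade hM).
move=> i x; rewrite mem_grade_restriction; split=> [xi y|x0].
  by rewrite mem_grade_restriction; apply: (pol_grade hM).
have [y [z [yU yi zU zi xE]]] := graded_decomp i sU (subvsP x).
suff z0 : z = 0 by rewrite xE z0 addr0.
apply: (pol_nondeg hM) => w; have [u [v [uU vU' ->]]] := decP w.
rewrite (pol_addr hM) [lam z v]orth // addr0.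
have [u1 [u2 [u1U u1i u2U u2i ->]]] := graded_decomp i sU uU.
rewrite (pol_addr hM) [lam z u2](pol_grade hM zi) // addr0.
have -> : z = vsval x - y by rewrite xE addrC addKr.
have := x0 (vsproj U u1); rewrite mem_grade_restriction /= vsprojK // => /(_ u1i) x0u.
by rewrite (pol_addl hM) x0u -scaleN1r (pol_scalel hM) (pol_grade hM yi) // mulr0 addr0.
Qed.

Lemma restriction_iso (U U' : {vspace M}) :
  graded_submodule U -> graded_submodule U' -> (U + U' = fullv)%VS ->
  (U :&: U' = 0)%VS -> (forall x y, x \in U -> y \in U' -> lam x y = 0) ->
  unitary_iso M (unitary_dsum (restriction U) (restriction U')).
Proof.
move=> sU sU' dec disj orth.
pose N := unitary_dsum (restriction U) (restriction U').
pose psi (x : N) : M := vsval x.1 + vsval x.2.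
have psi_linear : linear psi by move=> a x y; rewrite /psi /= scalerDr addrACA.
pose psi_lin := GRing.isLinear.Build k N M *:%R psi psi_linear.
pose Psi : {linear N -> M} := HB.pack psi psi_lin.
apply: (@unitary_iso_inverse _ _ _ Psi).
- move=> [x1 x2] [y1 y2]; rewrite /Psi /= /psi /= => eq_psi.
  have eq1 : vsval x1 - vsval y1 = vsval y2 - vsval x2.
    rewrite -{1}[vsval x1](addrK (vsval x2)) eq_psi addrAC.
    by rewrite [vsval y1 + _]addrC addrK.
  have : vsval x1 - vsval y1 \in (U :&: U')%VS.
    by rewrite memv_cap {2}eq1 !memvB ?subvsP.
  rewrite disj memv0 => d0; have d2 := d0; rewrite eq1 subr_eq0 in d2.
  rewrite subr_eq0 in d0.
  by congr pair; apply: subvs_inj; rewrite ?(eqP d0) ?(eqP d2).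
- move=> y; have : y \in (U + U')%VS by rewrite dec memvf.
  case/memv_addP=> u uU [v vU' ->]; exists (vsproj U u, vsproj U' v).
  by rewrite /Psi /= /psi /= !vsprojK.
- by move=> [x1 x2]; rewrite /Psi /= /psi !vsval_Fr // (FrD hM).
- by move=> [x1 x2]; rewrite /Psi /= /psi !vsval_Ve // (VeD hM).
- move=> [x1 x2] [y1 y2]; rewrite /Psi /= /psi /= (pol_addl hM) !(pol_addr hM).
  rewrite [lam (vsval x1) (vsval y2)]orth ?subvsP // addr0.
  have -> : lam (vsval x2) (vsval y1) = 0 by rewrite (pol_skew hM) orth ?subvsP ?oppr0.
  by rewrite add0r.
- move=> e x; rewrite memv_cap -!memv_preim !lfunE /= => /andP[x1 x2].
  by rewrite /Psi /= memvD.
- move=> [x1 x2].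
  have [y1 [z1 [y1U y1G z1U z1G x1E]]] := sub_graded sU (subvsP x1).
  have [y2 [z2 [y2U y2G z2U z2G x2E]]] := sub_graded sU' (subvsP x2).
  exists (vsproj U y1, vsproj U' y2), (vsproj U z1, vsproj U' z2).
  split; try by rewrite memv_cap -!memv_preim !lfunE /= !vsprojK // ?y1G ?z1G.
  by congr pair; apply: subvs_inj; rewrite linearD /= !vsprojK.
by case: hM => _ _ [].
Qed.

Lemma restriction_nonzero (U : {vspace M}) : U != 0%VS -> nonzero (restriction U).
Proof.
rewrite -vpick0 => u0; exists (vsproj U (vpick U)); apply: contra_neq u0 => u0.
by rewrite -(vsprojK (memv_pick U)) u0 linear0.
Qed.

(** [orth U] is again a graded submodule, by adjunction of [F] and [V], and nondegeneracy makes it a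
    complement of [U]; so it must be 0. *)
Lemma indecomposable_nondegenerate (U : {vspace M}) : indecomposable p M ->
  graded_submodule U -> U != 0%VS ->
  (forall x, x \in U -> (forall y, y \in U -> lam x y = 0) -> x = 0) -> U = fullv.
Proof.
move=> [_ indec] sU U0 nondeg; pose U' := orth U.
have inU' := mem_orth hM U.
have disj : (U :&: U' = 0)%VS.
  apply/eqP; rewrite -subv0; apply/subvP=> x /memv_capP[xU /inU' x0].
  rewrite memv0; apply/eqP/nondeg => // y yU; by rewrite (pol_skew hM) x0 ?oppr0.
have dec : (U + U')%VS = fullv.
  apply/eqP; rewrite eqEdim subvf dimv_disjoint_sum //.
  by have := dim_orth_geq U fullv; rewrite capfv addnC.
have sU' : graded_submodule U'.
  split=> [x /inU' x0|x /inU' x0|x /inU' x0].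
  - apply/inU' => u uU; rewrite (pol_Frr hp hM) x0 ?(expp0 hp) //.
    exact: sub_Ve.
  - apply/inU' => u uU; apply/eqP; have := x0 (F u) (sub_Fr sU uU).
    by rewrite (pol_Frl hM) => /eqP; rewrite expf_eq0 => /andP[].
  have [y [z [yG zG xE]]] := grade_decomp hM false x.
  have yU' : y \in U'.
    apply/inU' => u /(graded_decomp false sU)[v [w [vU vG wU wG ->]]].
    rewrite (pol_addl hM) (pol_grade hM vG) // add0r -(x0 w wU) xE (pol_addr hM).
    by rewrite (pol_grade hM wG zG) addr0.
  exists y, z; split=> //; rewrite -(addKr y z) -xE addrC memvB //.
  exact/inU'.
have [/eqP U'0|U'0] := boolP (U' == 0%VS); first by rewrite -dec U'0 addv0.
case: indec; exists (restriction U), (restriction U'); split.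
- apply: restriction_unitary sU sU' dec disj _ => x y xU /inU'; exact.
- have dec' : (U' + U)%VS = fullv by rewrite addvC.
  apply: restriction_unitary sU' sU dec' _ _; first by rewrite capvC.
  by move=> x y /inU' x0 yU; rewrite (pol_skew hM) x0 ?oppr0.
- exact: restriction_nonzero.
- exact: restriction_nonzero.
apply: restriction_iso => // x y xU /inU'; exact.
Qed.

End Summands.

(** * Powers of unipotent maps in characteristic p *)

Section UnipotentPower.
Variables (k : fieldType) (p : nat) (W : lmodType k).
Hypothesis hp : p \in [pchar k].

Lemma iter_binomial (g D : W -> W) n y : {morph D : a b / a + b} ->
  (forall a, g a = a + D a) ->
  iter n g y = \sum_(i < n.+1) iter i D y *+ 'C(n, i).
Proof.
move=> DD gD; have D0 : D 0 = 0 by apply: (addrI (D 0)); rewrite -DD !addr0.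
have Dn m a : D (a *+ m) = D a *+ m by elim: m => // m IH; rewrite !mulrS DD IH.
elim: n => [|n IHn]; first by rewrite big_ord1 bin0.
rewrite iterS IHn gD (big_morph D DD D0) big_ord_recl [in RHS]big_ord_recl /= !bin0.
rewrite -addrA; congr (_ + _).
under [in RHS]eq_bigr => i _ do rewrite /bump leq0n add1n binS mulrnDr.
rewrite big_split /= [X in _ = X + _]big_ord_recr /= bin_small // mulr0n addr0.
by congr (_ + _); apply: eq_bigr => i _; rewrite /bump ?leq0n ?add1n ?Dn.
Qed.

(** [(1 + D)^p = 1 + D^p], as the inner binomial coefficients are divisible by [p]; the induction
    replaces [g] and [D] by their [p]-th iterates. *)
Lemma iter_pchar_pow (g D : W -> W) n y : {morph D : a b / a + b} ->
  (forall a, g a = a + D a) -> iter (p ^ n) g y = y + iter (p ^ n) D y.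
Proof.
elim: n g D y => [|n IHn] g D y DD gD; first by rewrite expn0 /= gD.
rewrite expnSr !iterM; apply: IHn => [a b|a].
  by elim: p => // m IH; rewrite !iterS IH DD.
rewrite (iter_binomial p a DD gD) big_ord_recl bin0.
have p_pr := pcharf_prime hp; have p_gt0 := prime_gt0 p_pr.
have lt_p : (p.-1 < p)%N by rewrite ltn_predL.
rewrite (bigD1 (Ordinal lt_p)) //= big1 => [|i neq_i].
  by rewrite addr0 /bump leq0n add1n -iterS prednK // binn !mulr1n.
rewrite /bump leq0n add1n -scaler_nat.
have /dvdnP[q ->] : (p %| 'C(p, i.+1))%N.
  rewrite prime_dvd_bin //= ltn_neqAle ltn_ord andbT.
  by apply: contraNneq neq_i => ip; apply/eqP/val_inj/succn_inj; rewrite ip prednK.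
by rewrite natrM (pcharf0 hp) mulr0 scale0r.
Qed.

End UnipotentPower.

(** * Triangular frames and their orthogonalization *)

Section Frames.
Variables (k : closedFieldType) (p : nat).
Hypothesis hp : p \in [pchar k].
Hypothesis hp2 : (2 < p)%N.
Variable M : unitary_data k.
Hypothesis hM : is_unitary_BT1 p M.
Local Notation F := (@Fr k M).
Local Notation V := (@Ve k M).
Local Notation lam := (@pol k M).
Local Notation G := (grade M).

(** In the application each index stands for a block: [next] is the successor, [st] the dual block,
    [u] the letter, [e] the degree, and [s] the dimension of the lower space. *)
Variables (I : finType) (x : I -> M) (next st : I -> I) (u e : I -> bool) (s : I -> nat).
Hypothesis x_grade : forall i, x i \in G (e i).
Hypothesis x_link : forall i, link (u i) (x i) (x (next i)).
Hypothesis next_inj : injective next.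
Hypothesis stK : involutive st.
Hypothesis u_st : forall i, u (st i) = ~~ u i.
Hypothesis next_st : forall i, next (st i) = st (next i).
Hypothesis pol_st : forall i, lam (x i) (x (st i)) != 0.
(* The Gram matrix, with its columns permuted by [st], is triangular. *)
Hypothesis triangular : forall i j, lam (x i) (x j) != 0 -> j = st i \/ (s (st j) < s i)%N.

(** Triangular elimination: testing against [x (st i)] leaves [c i] and coefficients [c j] with
    [s (st j) < s (st i)], which vanish by induction. *)
Lemma frame_nondeg (c : I -> k) :
  (forall j, lam (x j) (\sum_i c i *: x i) = 0) -> forall i, c i = 0.
Proof.
move=> c0 i; have [n] := ubnP (s (st i)); elim: n i => // n IHn i lt_n.
have := c0 (st i); rewrite (pol_sumr hM) (bigD1 i) //= big1 => [|j neq_ji].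
  rewrite addr0 (pol_scaler hM) => /eqP; rewrite mulf_eq0 => /orP[/eqP //|].
  by rewrite -{2}(stK i) (negPf (pol_st _)).
rewrite (pol_scaler hM); have [->|/triangular[jE|lt]] := eqVneq (lam (x (st i)) (x j)) 0.
- by rewrite mulr0.
- by rewrite jE stK eqxx in neq_ji.
by rewrite IHn ?mul0r // (leq_trans lt).
Qed.

Lemma frame_free (c : I -> k) : \sum_i c i *: x i = 0 -> forall i, c i = 0.
Proof. by move=> c0; apply: frame_nondeg => j; rewrite c0 (pol0r hM). Qed.

Let next_bij : bijective next := injF_bij next_inj.

Lemma frame_Fr i : F (x i) = if u i then x (next i) else 0.
Proof.
have := x_link i; rewrite /link; case: ifP => // _ <-; exact: FrVe hM _.
Qed.

Lemma frame_Ve i : V (x (next i)) = if u i then 0 else x i.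
Proof.
have := x_link i; rewrite /link; case: ifP => // _ <-; exact: VeFr hM _.
Qed.

Lemma frame_span (i0 : I) : indecomposable p M -> forall y, exists c, y = \sum_i c i *: x i.
Proof.
move=> indec; pose U := (\sum_i <[x i]>)%VS.
have inU y : y \in U <-> exists c, y = \sum_i c i *: x i.
  split=> [/memv_sumP[f fP ->]|[c ->]]; last first.
    by apply: memv_sumr => i _; rewrite memvZ ?memv_line.
  have [i|c cP] := @fin_all_exists _ _ (fun i a => f i = a *: x i).
    by have /vlineP := fP i isT.
  by exists c; apply: eq_bigr => i _.
have xU i : x i \in U by apply/(subvP (sumv_sup i _ (subvv _)) _ (memv_line _)).
suff UT : U = fullv by move=> y; apply/inU; rewrite UT memvf.
apply: (indecomposable_nondegenerate hp hM indec).
- split=> y /inU[c ->].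
  + rewrite (semilinear_sum (FrD hM)) memv_suml // => i _.
    by rewrite (FrZ hM) memvZ // frame_Fr; case: ifP; rewrite ?mem0v.
  + rewrite (semilinear_sum (VeD hM)) memv_suml // => i _.
    have [prev _ prevK] := next_bij; rewrite -(prevK i).
    by rewrite (VeZ hp hM) memvZ // frame_Ve; case: ifP; rewrite ?mem0v.
  exists (\sum_(i | ~~ e i) c i *: x i), (\sum_(i | e i) c i *: x i); split.
  + by rewrite memv_suml // => i _; rewrite memvZ.
  + rewrite memv_suml // => i /negbTE <-; by rewrite memvZ.
  + by rewrite memv_suml // => i _; rewrite memvZ.
  + rewrite memv_suml // => i <-; by rewrite memvZ.
  by rewrite (bigID e) addrC.
- apply: contraTneq (pol_st i0) => U0; have := xU i0.
  by rewrite U0 memv0 => /eqP->; rewrite (pol0l hM) eqxx.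
move=> _ /inU[c ->] c0; rewrite big1 // => i _; rewrite (@frame_nondeg c) ?scale0r //.
by move=> j; rewrite (pol_skew hM) c0 ?oppr0.
Qed.

Let gam i := lam (x (st i)) (x i).

Let gam_neq0 i : gam i != 0.
Proof. by rewrite /gam -{2}(stK i). Qed.

Let gam_next i : gam (next i) = gam i ^+ p.
Proof.
rewrite /gam -next_st; apply: (link_pol hp hM (u := u (st i))) => //.
by rewrite u_st negbK.
Qed.

Let gam_st i : gam (st i) = - gam i.
Proof. by rewrite /gam stK (pol_skew hM). Qed.

(* [lam x y] is the value at [gram x] and [y] of the form whose Gram matrix in the
   frame is obtained from that of [lam] by keeping only the entries [(i, st i)]. *)
Definition gram (y : M) : M := \sum_j (lam y (x j) / gam j) *: x (st j).

Lemma gramD : {morph gram : y z / y + z}.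
Proof.
move=> y z; rewrite -big_split; apply: eq_bigr => j _.
by rewrite (pol_addl hM) mulrDl scalerDl.
Qed.

Lemma gramZ a y : gram (a *: y) = a *: gram y.
Proof.
rewrite scaler_sumr; apply: eq_bigr => j _.
by rewrite (pol_scalel hM) scalerA mulrA.
Qed.

Lemma gram_adjoint y z : lam (gram y) z = lam y (gram z).
Proof.
rewrite (pol_suml hM) (pol_sumr hM) [RHS](reindex_inj (inv_inj stK)).
apply: eq_bigr => j _; rewrite (pol_scalel hM) (pol_scaler hM) stK gam_st.
rewrite [lam z _](pol_skew hM) invrN mulrNN.
by rewrite [LHS]mulrC [LHS]mulrCA [LHS]mulrC.
Qed.

(** The terms match one by one: [V] brings [x (next i)] back to [x i] exactly when [F] moves
    [x (st i)] forward, because [st] negates letters. *)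
Lemma gram_Fr y : gram (F y) = F (gram y).
Proof.
rewrite [LHS](reindex_inj next_inj) (semilinear_sum (FrD hM)); apply: eq_bigr => i _.
rewrite (FrZ hM) frame_Fr u_st gam_next -next_st (pol_Frl hM) frame_Ve exprMn exprVn.
by case: (u i); rewrite //= (pol0r hM) (expp0 hp) !mul0r ?scale0r ?scaler0.
Qed.

Lemma gram_Ve y : gram (V y) = V (gram y).
Proof.
rewrite [RHS](semilinear_sum (VeD hM)) [RHS](reindex_inj next_inj); apply: eq_bigr => i _.
rewrite (VeZ hp hM) -next_st frame_Ve u_st gam_next.
have := pol_Frr hp hM y (x i); rewrite frame_Fr.
case: (u i) => /= [->|]; first by rewrite -expr_div_n exp_pK.
rewrite (pol0r hM) => /esym/eqP; rewrite expf_eq0 => /andP[_ /eqP->].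
by rewrite mul0r scale0r scaler0.
Qed.

Lemma e_st i : e (st i) = ~~ e i.
Proof.
apply/eqP; apply: contraNeq (pol_st i) => ne.
have eqe : e (st i) = e i by case: (e i) (e (st i)) ne => -[].
by rewrite (pol_grade hM (x_grade i)) // -eqe.
Qed.

Lemma gram_grade b y : y \in G b -> gram y \in G b.
Proof.
move=> yb; rewrite memv_suml // => j _; have [ej|ej] := eqVneq (e (st j)) b.
  by rewrite memvZ // -ej.
have -> : lam y (x j) = 0.
  apply: (pol_grade hM yb); rewrite (_ : b = e j) //.
  by move: ej; rewrite e_st; case: (e j) (b) => -[].
by rewrite mul0r scale0r mem0v.
Qed.

Definition gram_sub1 y := gram y - y.

Lemma gram_sub1D : {morph gram_sub1 : y z / y + z}.
Proof. by move=> y z; rewrite /gram_sub1 gramD opprD addrACA. Qed.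

Lemma gram_sub1Z a y : gram_sub1 (a *: y) = a *: gram_sub1 y.
Proof. by rewrite /gram_sub1 gramZ scalerBr. Qed.

Lemma gram_sub1_x i : gram_sub1 (x i) \in (\sum_(j | (s j < s i)%N) <[x j]>)%VS.
Proof.
rewrite /gram_sub1 /gram (bigD1 (st i)) //= [gam (st i)]/gam stK divff // scale1r.
rewrite addrAC subrr add0r memv_suml // => j neq_j.
have [->|/triangular[jE|lt]] := eqVneq (lam (x i) (x j)) 0.
- by rewrite mul0r scale0r mem0v.
- by rewrite jE eqxx in neq_j.
rewrite memvZ //; exact: (subvP (sumv_sup (st j) lt (subvv _)) _ (memv_line _)).
Qed.

Lemma gram_sub1_nilp n i : (s i < n)%N -> iter n gram_sub1 (x i) = 0.
Proof.
elim: n i => // n IHn i lt_n; rewrite iterSr.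
have addn0 : iter n gram_sub1 0 = 0.
  by elim: n {IHn lt_n} => //= n ->; rewrite (semilinear0 gram_sub1D).
have /memv_sumP[f fP ->] := gram_sub1_x i.
have itD : {morph iter n gram_sub1 : y z / y + z}.
  by elim: n {IHn lt_n addn0} => // n IH y z; rewrite !iterS IH gram_sub1D.
have itZ a y : iter n gram_sub1 (a *: y) = a *: iter n gram_sub1 y.
  by elim: n {IHn lt_n addn0 itD} => // n IH; rewrite !iterS IH gram_sub1Z.
rewrite (big_morph _ itD addn0) big1 // => j lt; have /vlineP[a ->] := fP j lt.
by rewrite itZ IHn ?scaler0 // (leq_trans lt).
Qed.

(* [gram] is self-adjoint and unipotent, so [gram^q = 1] for some power [q] of [p];
   as [q] is odd, [gram^((q-1)/2)] is an inverse square root of [gram], and it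
   carries the frame to an orthogonal one. *)
Lemma orthogonal_frame (i0 : I) : indecomposable p M ->
  exists x' : I -> M,
    [/\ forall i, x' i \in G (e i), forall i, link (u i) (x' i) (x' (next i)),
        forall i j, lam (x' i) (x' j) = if j == st i then lam (x i) (x (st i)) else 0,
        forall c : I -> k, \sum_i c i *: x' i = 0 -> forall i, c i = 0
      & forall y, exists c, y = \sum_i c i *: x' i].
Proof.
move=> indec; have span := frame_span i0 indec.
have itD n : {morph iter n gram : y z / y + z}.
  by elim: n => // n IH y z; rewrite !iterS IH gramD.
have itZ n a y : iter n gram (a *: y) = a *: iter n gram y.
  by elim: n => // n IH; rewrite !iterS IH gramZ.
have it0 n : iter n gram 0 = 0 by elim: n => //= n ->; rewrite (semilinear0 gramD).
have it_sum n (c : I -> k) (z : I -> M) :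
    iter n gram (\sum_i c i *: z i) = \sum_i c i *: iter n gram (z i).
  by rewrite (big_morph _ (itD n) (it0 n)); apply: eq_bigr => i _; rewrite itZ.
pose N := (\max_i s i).+1; pose q := (p ^ N)%N.
have itq y : iter q gram y = y.
  rewrite (@iter_pchar_pow _ _ _ hp _ gram_sub1) //; last 2 first.
  - exact: gram_sub1D.
  - by move=> a; rewrite /gram_sub1 addrC subrK.
  suff -> : iter q gram_sub1 y = 0 by rewrite addr0.
  have [c ->] := span y; have D0 n : iter n gram_sub1 0 = 0.
    by elim: n => //= n ->; rewrite (semilinear0 gram_sub1D).
  have DD n : {morph iter n gram_sub1 : y z / y + z}.
    by elim: n => // n IH a b; rewrite !iterS IH gram_sub1D.
  have DZ n a z : iter n gram_sub1 (a *: z) = a *: iter n gram_sub1 z.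
    by elim: n => // n IH; rewrite !iterS IH gram_sub1Z.
  rewrite (big_morph _ (DD q) (D0 q)) big1 // => i _; rewrite DZ gram_sub1_nilp ?scaler0 //.
  rewrite (@leq_trans N) ?ltnS ?leq_bigmax //.
  by rewrite ltnW // ltn_expl // prime_gt1 // (pcharf_prime hp).
pose t := (q.-1./2)%N.
have q_gt0 : (0 < q)%N by rewrite expn_gt0 prime_gt0 // (pcharf_prime hp).
have tq : (t + t)%N = q.-1.
  rewrite addnn -[RHS]odd_double_half [odd _](_ : _ = false) //.
  apply/negbTE; rewrite -oddS prednK // oddX orbC.
  by have /even_prime[p2|->] := pcharf_prime hp; first by move: hp2; rewrite p2.
exists (fun i => iter t gram (x i)).
(* Self-adjointness moves all [2 t = q - 1] factors to the right, giving [y] with [gram y = x j].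
   Comparing the coordinates of both sides in the frame reads off every [lam y (x i)]. *)
have orth i j : lam (iter t gram (x i)) (iter t gram (x j)) =
    if j == st i then lam (x i) (x (st i)) else 0.
  have adj n y z : lam (iter n gram y) z = lam y (iter n gram z).
    by elim: n y z => // n IH y z; rewrite iterSr IH gram_adjoint -iterS.
  rewrite adj -iterD tq; set y := iter q.-1 gram (x j).
  have gy : gram y = x j by rewrite -iterS prednK // itq.
  have := frame_free (c := fun l => lam y (x (st l)) / gam (st l) - (l == j)%:R).
  have -> : \sum_l (lam y (x (st l)) / gam (st l) - (l == j)%:R) *: x l = 0.
    under eq_bigr => l _ do rewrite scalerBl.
    rewrite sumrB [X in _ - X](bigD1 j) //= eqxx scale1r [X in _ - (_ + X)]big1.
      rewrite addr0 -[X in _ - X]gy [gram y](reindex_inj (inv_inj stK)).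
      by under [X in _ - X]eq_bigr => l _ do rewrite stK; rewrite subrr.
    by move=> l /negbTE ->; rewrite scale0r.
  move=> /(_ erefl (st i)) /eqP; rewrite stK subr_eq0 => /eqP yi.
  rewrite (pol_skew hM) -[lam y (x i)](divfK (gam_neq0 i)) yi eq_sym.
  case: (_ == _); rewrite ?mul0r ?oppr0 // mul1r.
  by rewrite /gam (pol_skew hM) opprK.
split=> //.
- move=> i; elim: (t) => [|n IH] /=; first exact: x_grade.
  exact: gram_grade.
- move=> i; have := x_link i; rewrite /link; case: (u i).
    by move=> <-; elim: (t) => //= n IH; rewrite -gram_Fr IH.
  by move=> <-; elim: (t) => //= n IH; rewrite -gram_Ve IH.
- move=> c c0 i; have := congr1 (fun y => lam (iter t gram (x (st i))) y) c0.
  rewrite (pol0r hM) (pol_sumr hM) (bigD1 i) //= big1 ?addr0 => [|j neq_j].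
    rewrite (pol_scaler hM) orth stK eqxx => /eqP; rewrite mulf_eq0 => /orP[/eqP|] //.
    by rewrite -/(gam i) (negPf (gam_neq0 i)).
  by rewrite (pol_scaler hM) orth stK (negPf neq_j) mulr0.
move=> y; have [c yc] := span (iter (q - t) gram y); exists c.
rewrite -it_sum -yc -iterD subnKC ?itq //.
by rewrite -(leq_add2l t) tq (leq_trans (leq_pred q)) // leq_addl.
Qed.

End Frames.

(** * Words and the classification *)

Section Words.

Lemma letter_rev_mkseq (u : nat -> bool) m j : (j < m)%N -> letter (rev (mkseq u m)) j = u j.
Proof. by move=> lt; rewrite /letter revK nth_mkseq. Qed.

Lemma dual_rev_mkseq (u : nat -> bool) m :
  dual (rev (mkseq u m)) = rev (mkseq (fun j => ~~ u j) m).
Proof. by rewrite /dual map_rev /mkseq -map_comp. Qed.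

Lemma size_power t n : size (power t n) = (n * size t)%N.
Proof. by rewrite /power size_flatten /shape map_nseq sumn_nseq mulnC. Qed.

Lemma letter_power t n j : (j < n * size t)%N -> letter (power t n) j = letter t (j %% size t).
Proof.
rewrite /letter; elim: n j => // n IHn j lt.
have powS : power t n.+1 = power t n ++ t.
  by elim: n {IHn lt} => [|n IHn]; rewrite /power /= ?cats0 // -catA -IHn.
rewrite powS rev_cat nth_cat size_rev; case: ltnP => [lt_j|le_j]; first by rewrite modn_small.
rewrite IHn; last by rewrite ltn_subLR // -mulSn.
by rewrite -{2}(subnK le_j) modnDr.
Qed.

Lemma letter_rotate w n j : (j < size w)%N ->
  letter (iter n rotate w) j = letter w ((j + n) %% size w).
Proof.
elim: n j => [|n IHn] j lt; first by rewrite addn0 modn_small.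
have size_it : size (iter n rotate w) = size w.
  by elim: n {IHn lt} => //= n IH; rewrite /rotate size_rotr.
have rot1 (r : word) i : (i < size r)%N -> nth false (rot 1 r) i = nth false r (i.+1 %% size r).
  case: r => // a r lt_i; rewrite rot1_cons nth_rcons /=.
  have [lt_ir|ge_ir] := ltnP i (size r); first by rewrite modn_small.
  have -> : i = size r by apply/eqP; rewrite eqn_leq ge_ir -ltnS lt_i.
  by rewrite eqxx modnn.
rewrite iterS {1}/letter /rotate rev_rotr rot1 ?size_rev size_it //.
rewrite -/(letter _ _) IHn ?ltn_mod ?(leq_ltn_trans _ lt) //.
by rewrite modnDml addSnnS.
Qed.

End Words.

Section WordModules.
Variables (k : closedFieldType) (p : nat).
Hypothesis hp : p \in [pchar k].
Variable M : unitary_data k.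
Hypothesis hM : is_unitary_BT1 p M.

Variables (w : word) (x : 'I_(size w) -> M).
Hypothesis x_link : forall i : 'I_(size w), link (letter w i) (x i) (x (ordS i)).

Definition word_map (r : 'rV[k]_(size w)) : M := \sum_i r 0 i *: x i.

Lemma word_map_linear : linear word_map.
Proof.
move=> a r t; rewrite /word_map scaler_sumr -big_split; apply: eq_bigr => i _.
by rewrite !mxE scalerDl scalerA.
Qed.

Lemma word_map0 : word_map 0 = 0.
Proof. by rewrite /word_map big1 // => i _; rewrite mxE scale0r. Qed.

Lemma word_map_delta i : word_map (delta_mx 0 i) = x i.
Proof.
rewrite /word_map (bigD1 i) //= big1 ?addr0 ?mxE ?eqxx ?scale1r // => j /negbTE ji.
by rewrite mxE eqxx ji scale0r.
Qed.

Lemma word_map_sum (J : finType) (P : pred J) (a : J -> k) (f : J -> 'I_(size w)) :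
  word_map (\sum_(j | P j) a j *: delta_mx 0 (f j)) = \sum_(j | P j) a j *: x (f j).
Proof.
have h := word_map_linear.
have D y z : word_map (y + z) = word_map y + word_map z.
  by have := h 1 y z; rewrite !scale1r.
have Z0 : word_map 0 = 0 by apply: (addrI (word_map 0)); rewrite -D !addr0.
rewrite (big_morph _ D Z0); apply: eq_bigr => j _.
by have := h (a j) (delta_mx 0 (f j)) 0; rewrite !addr0 Z0 addr0 word_map_delta.
Qed.

Lemma word_map_Fr r : word_map (@Fr _ (word_module k p w) r) = Fr (word_map r).
Proof.
rewrite /= word_map_sum big_mkcond (semilinear_sum (FrD hM)); apply: eq_bigr => i _.
rewrite (FrZ hM); have := x_link i; rewrite /link; case: (letter w i) => [-> //|<-].
by rewrite (FrVe hM) scaler0.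
Qed.

Lemma word_map_Ve r : word_map (@Ve _ (word_module k p w) r) = Ve (word_map r).
Proof.
rewrite /= (word_map_sum _ _ id) big_mkcond (semilinear_sum (VeD hM)).
rewrite [RHS](reindex_inj (@ordS_inj _)); apply: eq_bigr => i _.
rewrite (VeZ hp hM); have := x_link i; rewrite /link; case: (letter w i) => [<-|-> //].
by rewrite (VeFr hM) scaler0.
Qed.

End WordModules.

Section RowParity.
Variables (K : fieldType) (n : nat).

Definition parity_part (b : bool) (r : 'rV[K]_n) : 'rV[K]_n :=
  \sum_(j < n | odd j == b) r 0 j *: delta_mx 0 j.

Lemma parity_part_mem b r :
  parity_part b r \in (\sum_(j < n | odd j == b) <[delta_mx 0%R j : 'rV[K]_n]>)%VS.
Proof. by apply: memv_sumr => j _; rewrite memvZ ?memv_line. Qed.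

Lemma parity_partD r : r = parity_part false r + parity_part true r.
Proof.
rewrite {1}[r]row_sum_delta (bigID (fun j : 'I_n => odd j == false)) /=.
by congr (_ + _); apply: eq_bigl => j; case: (odd j).
Qed.

Lemma parity_part_inl (U : vectType K) b r :
  (parity_part b r, 0 : U) \in
    (\sum_(j < n | odd j == b) <[(delta_mx 0%R j : 'rV[K]_n, 0%R : U)]>)%VS.
Proof.
have -> : (parity_part b r, 0 : U) =
    \sum_(j < n | odd j == b) r 0 j *: (delta_mx 0 j : 'rV[K]_n, 0 : U).
  rewrite (big_morph (fun u : 'rV[K]_n => (u, 0 : U)) (id1 := 0) (op1 := +%R)) //.
    by apply: eq_bigr => j _; congr pair; rewrite scaler0.
  by move=> u v; congr pair; rewrite addr0.
by apply: memv_sumr => j _; rewrite memvZ ?memv_line.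
Qed.

Lemma parity_part_inr (U : vectType K) b r :
  (0 : U, parity_part b r) \in
    (\sum_(j < n | odd j == b) <[(0%R : U, delta_mx 0%R j : 'rV[K]_n)]>)%VS.
Proof.
have -> : (0 : U, parity_part b r) =
    \sum_(j < n | odd j == b) r 0 j *: (0 : U, delta_mx 0 j : 'rV[K]_n).
  rewrite (big_morph (fun u : 'rV[K]_n => (0 : U, u)) (id1 := 0) (op1 := +%R)) //.
    by apply: eq_bigr => j _; congr pair; rewrite scaler0.
  by move=> u v; congr pair; rewrite addr0.
by apply: memv_sumr => j _; rewrite memvZ ?memv_line.
Qed.

End RowParity.

(** * From a periodic block to a model *)

Section Assembly.
Variables (k : closedFieldType) (p : nat).
Hypothesis hp : p \in [pchar k].
Hypothesis hp2 : (2 < p)%N.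
Variable M : unitary_data k.
Hypothesis hM : is_unitary_BT1 p M.
Hypothesis hindec : indecomposable p M.
Variable d : nat.
Hypothesis d_gt0 : (0 < d)%N.
Hypothesis d_min : forall e (A B : {vspace M}), canonical e A -> canonical e B ->
  (A <= B)%VS -> A != B -> (\dim A + d <= \dim B)%N.
Local Notation lam := (@pol k M).
Local Notation G := (grade M).
Local Notation succ := (@succ k M).

(** Injectivity of [beta] reduces the identities between [next] and [st] to identities between
    blocks. *)
Lemma block_frame (I : finType) (i0 : I) (beta : I -> block M) (x : I -> M)
    (next st : I -> I) :
  (forall i, good d (beta i)) -> (forall i, x i \in high (beta i)) ->
  (forall i, link (blk_letter (beta i)) (x i) (x (next i))) ->
  injective beta -> injective next ->
  (forall i, beta (next i) = succ (beta i)) ->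
  (forall i, beta (st i) = dual_block (beta i)) ->
  (forall i, lam (x i) (x (st i)) != 0) ->
  exists x' : I -> M,
    [/\ forall i, x' i \in G (deg (beta i)),
        forall i, link (blk_letter (beta i)) (x' i) (x' (next i)),
        forall i j, lam (x' i) (x' j) = if j == st i then lam (x i) (x (st i)) else 0,
        forall c : I -> k, \sum_i c i *: x' i = 0 -> forall i, c i = 0
      & forall y, exists c, y = \sum_i c i *: x' i].
Proof.
move=> gb xB xl beta_inj next_inj beta_next beta_st pol_st.
apply: (@orthogonal_frame _ _ hp hp2 _ hM _ x next st (fun i => blk_letter (beta i))
  (fun i => deg (beta i)) (fun i => \dim (low (beta i)))) => //.
- by move=> i; apply: (subvP (high_grade hp hM (gb i))).
- by move=> i; apply: beta_inj; rewrite !beta_st (dual_blockK hp hM (gb i)).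
- by move=> i; rewrite beta_st (dual_letter hp hM d_gt0 d_min).
- move=> i; apply: beta_inj; rewrite beta_next !beta_st beta_next.
  by rewrite (dual_succ hp hM d_gt0 d_min).
move=> i j /(block_pol hp hM d_gt0 d_min (gb i) (gb j) (xB i) (xB j)).
rewrite -!beta_st; case=> [/beta_inj->|]; first by left.
by right.
Qed.

Variables (b : block M) (m : nat).
Hypothesis gb : good d b.
Hypothesis deg_b : deg b = false.
Hypothesis m_gt0 : (0 < m)%N.
Hypothesis per : iter m succ b = b.
Hypothesis m_min : forall j, (0 < j < m)%N -> iter j succ b != b.

Let lbl j := blk_letter (iter j succ b).

Lemma period_even : ~~ odd m.
Proof. by have := deg_iter m b; rewrite per deg_b addbF => <-. Qed.

Lemma iter_minimal_eq j : iter j succ b = b -> (m %| j)%N.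
Proof.
move=> perj; rewrite /dvdn; apply: contraT => neq0.
have := m_min (j := (j %% m)%N); rewrite iter_periodic // perj eqxx => /(_ _)/negP[] //.
by rewrite lt0n neq0 ltn_mod.
Qed.

Lemma iter_block_inj i j : (i < m)%N -> (j < m)%N -> iter i succ b = iter j succ b -> i = j.
Proof.
move=> lt_i lt_j eq_ij.
have := iter_minimal_eq (j := (m - i + j)%N).
rewrite iterD -eq_ij -iterD subnK ?(ltnW lt_i) // => /(_ per) /dvdnP[q qE].
have q1 : q = 1 by nia.
by rewrite q1 mul1n in qE; lia.
Qed.

Lemma lbl_mod j : lbl (j %% m) = lbl j.
Proof. by rewrite /lbl iter_periodic. Qed.

Lemma lbl_iter n j : blk_letter (iter j succ (iter n succ b)) = lbl (j + n).
Proof. by rewrite /lbl iterD. Qed.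

(** An even shift keeps the degree, so the shifted block has the letters and the degree of [b] and
    equals [b]. An odd period of the letters would only give a block of the other degree. *)
Lemma letter_period t : ~~ odd t -> (forall j, lbl (j + t) = lbl j) -> (m %| t)%N.
Proof.
move=> even_t lblt; apply: iter_minimal_eq.
have per_t : iter m succ (iter t succ b) = iter t succ b by rewrite -iterD addnC iterD per.
apply: (periodic_block_unique hp hM d_gt0 d_min _ gb _ m_gt0 per_t per).
- exact: (good_iter hp hM d_gt0 d_min).
- by rewrite deg_iter (negPf even_t).
by move=> j _; rewrite lbl_iter lblt.
Qed.

Let w : word := rev (mkseq lbl m).

Lemma size_w : size w = m. Proof. by rewrite size_rev size_mkseq. Qed.

Lemma letter_w j : letter w (j %% m) = lbl j.
Proof. by rewrite letter_rev_mkseq ?ltn_mod // lbl_mod. Qed.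

(** An even [size t] would be a period of the cycle smaller than [m]. So it is odd, its double is an
    even period, and [m] divides that double. *)
Lemma w_power t r : w = power t r -> (1 < r)%N ->
  [/\ odd (size t), r = 2, m = (size t + size t)%N & forall j, lbl (j + size t) = lbl j].
Proof.
move=> wE r_gt1; have sz : m = (r * size t)%N by rewrite -size_power -wE size_w.
have lblE j : lbl j = letter t (j %% size t).
  rewrite -letter_w wE letter_power -?sz ?ltn_mod //; congr letter.
  by rewrite modn_dvdm // sz dvdn_mull.
have lbl_t j : lbl (j + size t) = lbl j by rewrite !lblE modnDr.
have t_gt0 : (0 < size t)%N by lia.
have odd_t : odd (size t).
  by apply/negPn/negP => even_t; have := dvdn_leq t_gt0 (letter_period even_t lbl_t); nia.
suff r2 : r = 2 by split=> //; rewrite sz r2 mul2n addnn.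
apply/eqP; rewrite eqn_leq r_gt1 andbT; have /dvdn_leq : (m %| size t + size t)%N.
  by apply: letter_period => [|j]; rewrite ?addnn ?odd_double // -addnn addnA !lbl_t.
by rewrite addn_gt0 t_gt0 => /(_ isT); nia.
Qed.

Lemma chain_mod (x : nat -> M) c j : chain m c x -> x (j %% m)%N = x j.
Proof.
case=> _ _ xper; rewrite {2}(divn_eq j m) addnC; elim: (j %/ m)%N => [|q IHq].
  by rewrite addn0.
by rewrite mulSn addnCA addnC xper.
Qed.

Section SelfDualBlock.
Variable n : nat.
Hypothesis lt_nm : (n < m)%N.
Hypothesis dual_b : iter n succ b = dual_block b.

Lemma double_n : m = (n + n)%N.
Proof.
have n_neq0 : n != 0.
  apply: contra_eq_neq dual_b => ->; apply/eqP => /(congr1 (@deg k M)).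
  by rewrite [deg (dual_block b)]/(~~ deg b) deg_b.
have /dvdnP[q] : (m %| n + n)%N.
  apply: iter_minimal_eq; rewrite iterD dual_b -(dual_iter hp hM d_gt0 d_min) //.
  by rewrite dual_b (dual_blockK hp hM gb).
by case: q => [|[|q]]; nia.
Qed.

Lemma odd_n : odd n.
Proof.
have := deg_iter n b; rewrite dual_b deg_b addbF => <-.
by rewrite /deg /= -/(deg b) deg_b.
Qed.

Lemma lbl_dual j : lbl (j + n) = ~~ lbl j.
Proof.
rewrite /lbl iterD dual_b -(dual_iter hp hM d_gt0 d_min) // (dual_letter hp hM d_gt0 d_min) //.
exact: (good_iter hp hM d_gt0 d_min).
Qed.

Let Q := (p ^ n)%N.

Lemma self_chain_pol (x z : nat -> M) j : chain m b x -> chain m b z ->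
  lam (x j) (z (j + n)%N) = lam (x 0) (z n) ^+ (p ^ j).
Proof.
move=> cx cz; have cz' : chain m (dual_block b) (fun i => z (i + n)%N).
  by rewrite -dual_b; apply: (chain_shift n cz).
exact: (chain_pol hp hM d_gt0 d_min j gb cx cz').
Qed.

Lemma self_chain_skew (x z : nat -> M) : chain m b x -> chain m b z ->
  lam (z 0) (x n) = - lam (x 0) (z n) ^+ Q.
Proof.
move=> cx cz; rewrite -(self_chain_pol n cx cz) -double_n (pol_skew hM).
by rewrite -[z m](chain_mod m cz) modnn.
Qed.

(* [(x, z) |-> lam (x 0) (z n)] is a skew-hermitian form on the space of chains over
   the field with [p^m = Q^2] elements; [c / h^Q] is chosen to make a combination of
   two isotropic chains with product [h] nonisotropic. *)
Lemma self_chain_exists (c : k) : c != 0 -> c ^+ Q = - c ->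
  exists z, chain m b z /\ lam (z 0) (z n) = c.
Proof.
move=> c0 cQ.
have qE : (p ^ m)%N = (Q * Q)%N by rewrite double_n expnD.
have N1 : 1 != -1 :> k.
  rewrite -subr_eq0 opprK -[1 + 1]/(2%:R) -(dvdn_pcharf hp) gtnNdvd //.
have expN (a : k) : (- a) ^+ Q = - a ^+ Q by apply: exp_pcharN.
have nonisotropic : exists z, chain m b z /\ lam (z 0) (z n) != 0.
  have [x [cx x0]] := chain_exists_low hp hM d_gt0 d_min gb m_gt0 per.
  have [y [cy xy]] := dual_chain hp hM d_gt0 d_min gb m_gt0 per cx x0.
  pose y' j := y (j + n)%N.
  have cy' : chain m b y'.
    rewrite -(dual_blockK hp hM gb) -dual_b (dual_iter hp hM d_gt0 d_min) //.
    exact: chain_shift.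
  pose h := lam (x 0) (y' n); have h0 : h != 0.
    by rewrite /h /y' -double_n -[y m](chain_mod m cy) modnn.
  have [Hx|] := eqVneq (lam (x 0) (x n)) 0; last by exists x.
  have [Hy|] := eqVneq (lam (y' 0) (y' n)) 0; last by exists y'.
  have hq : h ^+ (p ^ m) = h.
    rewrite -(self_chain_pol m cx cy') -[x m](chain_mod m cx) modnn.
    by rewrite addnC -[y' (n + m)%N](chain_mod (n + m) cy') modnDr (chain_mod n cy').
  pose a := c / h ^+ Q.
  have cq : c ^+ (p ^ m) = c by rewrite qE exprM cQ expN cQ opprK.
  have aq : a ^+ (p ^ m) = a by rewrite /a expr_div_n cq -!exprM mulnC exprM hq.
  exists (fun j => x j + a ^+ (p ^ j) *: y' j); split.
    exact: (chainD hM cx (chainZ hp hM aq cy')).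
  (* The value is [a^Q h - a h^Q = - 2 c], nonzero because [p] is odd. *)
  rewrite (pol_addl hM) !(pol_addr hM) !(pol_scalel hM) !(pol_scaler hM) Hx Hy.
  rewrite !mulr0 addr0 add0r (self_chain_skew cx cy') expr1 -/h.
  have -> : a ^+ (p ^ n) * h = - c.
    by rewrite /a expr_div_n cQ -exprM -qE hq divfK.
  rewrite mulrN /a divfK ?expf_neq0 // -opprD oppr_eq0 -mulr2n -mulr_natl mulf_neq0 //.
  by move: N1; rewrite -subr_eq0 opprK.
have [z [cz z0]] := nonisotropic; set g := lam (z 0) (z n) in z0.
have gQ : g ^+ Q = - g by rewrite {2}/g (self_chain_skew cz cz) opprK.
(* Scaling by [a] multiplies the form by the norm [a^(Q+1)]. Both [c] and [g] are negated by the
   [Q]-th power, so [c / g] is fixed by it, and this forces [a] into the field with [Q^2]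
   elements. *)
have [a aE] := @ex_root_exp k Q.+1 (c / g) isT.
have a0 : a != 0.
  by apply: contraTneq (mulf_neq0 c0 (invr_neq0 z0)) => a0; rewrite -aE a0 expr0n eqxx.
have aq : a ^+ (p ^ m) = a.
  have aQ : (a ^+ Q.+1) ^+ Q = a ^+ Q.+1.
    by rewrite aE expr_div_n cQ gQ invrN mulrNN.
  have aQ0 : a ^+ Q != 0 by rewrite expf_neq0.
  by apply: (mulIf aQ0); rewrite qE -exprD -exprS -aQ -exprM; congr (_ ^+ _); lia.
exists (fun j => a ^+ (p ^ j) *: z j); split; first exact: (chainZ hp hM aq cz).
rewrite (pol_scalel hM) (pol_scaler hM) -/g mulrA expr1 -exprS aE divfK //.
Qed.

End SelfDualBlock.

Lemma mod_w j : (j %% size w = j %% m)%N.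
Proof. by rewrite size_w. Qed.

Lemma lt_w (i : 'I_(size w)) : (i < m)%N.
Proof. by rewrite (leq_trans (ltn_ord i)) // size_w. Qed.

Lemma chain_ordS (x : nat -> M) c : chain m c x ->
  forall i : 'I_(size w), x (ordS i) = x i.+1.
Proof. by move=> cx i; rewrite /= mod_w (chain_mod _ cx). Qed.

Lemma letter_w_ord (i : 'I_(size w)) : letter w i = lbl i.
Proof. by rewrite -letter_w modn_small // lt_w. Qed.

Lemma iter_ordS c (i : 'I_(size w)) : iter m succ c = c ->
  iter (ordS i) succ c = succ (iter i succ c).
Proof. by move=> perc; rewrite /= mod_w iter_periodic. Qed.

Lemma iter_ord_inj : injective (fun i : 'I_(size w) => iter i succ b).
Proof. by move=> i j /iter_block_inj h; apply/val_inj/h; rewrite lt_w. Qed.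

Lemma unicycle_case (c : word -> k) n :
  (forall y : word, odd (size y) -> unicycle_constant p (size y) (c y)) ->
  (n < m)%N -> iter n succ b = dual_block b -> iso_unitary_unicycle p c M.
Proof.
move=> hc lt_nm dual_b; have mE := double_n lt_nm dual_b.
have lblD := lbl_dual dual_b.
(* Letters are numbered from the right, so the left half [y] carries those from [n] to [2 n - 1]. *)
pose y : word := rev (mkseq (fun j => lbl (n + j)) n).
have size_y : size y = n by rewrite size_rev size_mkseq.
have odd_y : odd (size y) by rewrite size_y (odd_n dual_b).
have wE : w = y ++ dual y.
  rewrite dual_rev_mkseq -rev_cat; congr rev; rewrite mE /mkseq iotaD map_cat.
  congr (_ ++ _); first by apply: eq_map => j; rewrite addnC lblD negbK.
  by have := iotaDl n 0 n; rewrite addn0 add0n => ->; rewrite -map_comp.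
exists y; split=> //; rewrite -?wE.
  (* A proper power would have root of length [n], but a shift by [n] negates the letters. *)
  split=> [w0|t r r_gt1 /w_power/(_ r_gt1)[_ _ mt lblt]].
    by have := size_w; rewrite w0 /=; lia.
  have tn : size t = n by lia.
  by have := lblt 0%N; rewrite tn lblD; case: (lbl _).
have [c0 cQ] := hc y odd_y; rewrite size_y in cQ.
have [z [cz zn]] := self_chain_exists lt_nm dual_b c0 cQ.
have [zB zl zper] := cz.
have lt_st (i : 'I_(size w)) : ((i + n) %% size w < size w)%N.
  by rewrite ltn_mod size_w.
pose st i : 'I_(size w) := Ordinal (lt_st i).
have z_st (i : 'I_(size w)) : lam (z i) (z (st i)) = c y ^+ (p ^ i).
  by rewrite /= mod_w (chain_mod _ cz) (self_chain_pol dual_b i cz cz) zn.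
have i0 : 'I_(size w) by exists 0%N; rewrite size_w.
have [||||||||x' [x'_grade x'_link x'_pol x'_free x'_span]] :=
  @block_frame _ i0 (fun i => iter i succ b) (fun i => z i) (@ordS _) st.
- by move=> i; apply: (good_iter hp hM d_gt0 d_min).
- by move=> i; apply: zB.
- by move=> i; rewrite (chain_ordS cz); apply: zl.
- exact: iter_ord_inj.
- exact: ordS_inj.
- by move=> i; apply: iter_ordS.
- move=> i; rewrite /= mod_w iter_periodic // iterD dual_b.
  by rewrite (dual_iter hp hM d_gt0 d_min).
- by move=> i; rewrite z_st expf_neq0.
(* The unicycle is restated over [w], so that [y ++ dual y] no longer occurs in the types. *)
suff : unitary_iso M (UnitaryData (bt1 := word_module k p w)
    (fun r s => \sum_(i < size w) \sum_(j < size w | j == (i + size y)%N %[mod (size y).*2])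
           c y ^+ (p ^ i) * (r : 'rV[k]_(size w)) 0 i * (s : 'rV[k]_(size w)) 0 j)
    (fun e => (\sum_(j < size w | odd j == e) <[delta_mx 0%R j : 'rV[k]_(size w)]>)%VS)).
  by rewrite wE.
set N := UnitaryData _ _.
have x'_link_w (i : 'I_(size w)) : link (letter w i) (x' i) (x' (ordS i)).
  by rewrite letter_w_ord; apply: x'_link.
pose psi_lin := GRing.isLinear.Build k N M *:%R (word_map x') (word_map_linear x').
pose psi : {linear N -> M} := HB.pack (word_map x') psi_lin.
apply: (@unitary_iso_inverse _ _ _ psi).
- move=> r s eq_rs; apply/rowP => i; apply/eqP; rewrite -subr_eq0; apply/eqP.
  apply: (x'_free (fun i => r 0 i - s 0 i)).
  under eq_bigr => j _ do rewrite scalerBl.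
  by rewrite sumrB; apply/eqP; rewrite subr_eq0; apply/eqP.
- move=> v; have [a ->] := x'_span v; exists (\row_i a i).
  by apply: eq_bigr => i _; rewrite mxE.
- exact: word_map_Fr.
- exact: word_map_Ve.
- move=> r s; rewrite /= /word_map (pol_suml hM); apply: eq_bigr => i _.
  rewrite (pol_sumr hM) [RHS]big_mkcond; apply: eq_bigr => j _.
  rewrite (pol_scalel hM) (pol_scaler hM) x'_pol z_st -val_eqE /= size_y -addnn -mE.
  rewrite mod_w [(j %% m)%N]modn_small ?lt_w //.
  by case: eqP => _; rewrite ?mulr0 // mulrA [LHS]mulrC mulrA.
- move=> e r; suff sub : (grade N e <= linfun psi @^-1: G e)%VS.
    by move/(subvP sub); rewrite -memv_preim lfunE.
  apply/subv_sumP=> j /eqP <-; rewrite -memvE -memv_preim lfunE /= word_map_delta.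
  by have := x'_grade j; rewrite deg_iter deg_b addbF.
- move=> r; exists (parity_part false r), (parity_part true r).
  by split; [exact: parity_part_mem | exact: parity_part_mem | exact: parity_partD].
by case: hM => _ _ [].
Qed.

Hypothesis not_dual : forall n, iter n succ b != dual_block b.

Lemma bicycle_case : unitary_iso M (bicycle k p w).
Proof.
have gd := good_dual hp hM d_gt0 gb.
have perd : iter m succ (dual_block b) = dual_block b.
  by rewrite -(dual_iter hp hM d_gt0 d_min) // per.
have [x [cx x0]] := chain_exists_low hp hM d_gt0 d_min gb m_gt0 per.
have [y' [cy' xy']] := dual_chain hp hM d_gt0 d_min gb m_gt0 per cx x0.
(* The pairing of two chains is fixed by the [p ^ m]-th power, so its inverse is a scalar allowed by
   [chainZ]. *)
have [y [cy xy]] : exists y, chain m (dual_block b) y /\ lam (x 0) (y 0) = 1.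
  pose a := (lam (x 0) (y' 0))^-1.
  have aq : a ^+ (p ^ m) = a.
    rewrite /a exprVn -(chain_pol hp hM d_gt0 d_min m gb cx cy').
    by rewrite -[x m](chain_mod m cx) -[y' m](chain_mod m cy') modnn.
  exists (fun j => a ^+ (p ^ j) *: y' j); split; first exact: (chainZ hp hM aq cy').
  by rewrite (pol_scaler hM) expr1 mulVf.
have xyj j : lam (x j) (y j) = 1.
  by rewrite (chain_pol hp hM d_gt0 d_min j gb cx cy) xy expr1n.
have [xB xl _] := cx; have [yB yl _] := cy.
have size_dw : size (dual w) = size w by rewrite size_map.
pose I := ('I_(size w) + 'I_(size (dual w)))%type.
pose beta (i : I) := match i with
  | inl i => iter i succ b | inr j => iter j succ (dual_block b) end.
pose z (i : I) := match i with inl i => x i | inr j => y j end.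
pose next (i : I) : I := match i with inl i => inl (ordS i) | inr j => inr (ordS j) end.
pose st (i : I) : I := match i with
  | inl i => inr (cast_ord (esym size_dw) i) | inr j => inl (cast_ord size_dw j) end.
have i0 : I by apply: inl; exists 0%N; rewrite size_w.
have mod_dw j : (j %% size (dual w) = j %% m)%N by rewrite size_dw size_w.
have lt_dw (j : 'I_(size (dual w))) : (j < m)%N.
  by rewrite (leq_trans (ltn_ord j)) // size_dw size_w.
have neq_dual i j : (j < m)%N -> iter i succ b <> iter j succ (dual_block b).
  move=> lt_j eq_ij; have := not_dual (m - j + i).
  by rewrite iterD eq_ij -iterD subnK ?(ltnW lt_j) // perd eqxx.
have [||||||||z' [z'_grade z'_link z'_pol z'_free z'_span]] :=
  @block_frame _ i0 beta z next st.
- by case=> i /=; apply: (good_iter hp hM d_gt0 d_min).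
- by case=> i; [apply: xB | apply: yB].
- case=> i /=; first by rewrite mod_w (chain_mod _ cx); apply: xl.
  by rewrite mod_dw (chain_mod _ cy); apply: yl.
- case=> i [] j /= eq_ij.
  + by congr inl; apply: iter_ord_inj.
  + by case: (neq_dual i j).
  + by case: (neq_dual j i).
  congr inr; apply/val_inj/iter_block_inj; rewrite ?lt_dw //.
  rewrite -!(dual_iter hp hM d_gt0 d_min) // in eq_ij.
  have := congr1 (@dual_block k M) eq_ij.
  have gi l : good d (iter l succ b) by apply: (good_iter hp hM d_gt0 d_min).
  by rewrite (dual_blockK hp hM (gi i)) (dual_blockK hp hM (gi j)).
- by case=> i [] j //= [h]; congr (_ _); apply/ordS_inj/val_inj.
- case=> i /=; first by rewrite mod_w iter_periodic.
  by rewrite mod_dw iter_periodic.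
- case=> i /=; first by rewrite (dual_iter hp hM d_gt0 d_min).
  by rewrite (dual_iter hp hM d_gt0 d_min) // (dual_blockK hp hM gb).
- by case=> i /=; rewrite ?xyj ?oner_neq0 // (pol_skew hM) xyj oppr_eq0 oner_neq0.
set N := bicycle k p w.
have link1 (i : 'I_(size w)) : link (letter w i) (z' (inl i)) (z' (inl (ordS i))).
  by rewrite letter_w_ord; apply: (z'_link (inl i)).
have link2 (j : 'I_(size (dual w))) :
    link (letter (dual w) j) (z' (inr j)) (z' (inr (ordS j))).
  have -> : letter (dual w) j = ~~ lbl j.
    by move: (nat_of_ord j) (lt_dw j) => i lt_i; rewrite dual_rev_mkseq letter_rev_mkseq.
  have := z'_link (inr j); rewrite /= -(dual_iter hp hM d_gt0 d_min) //.
  by rewrite (dual_letter hp hM d_gt0 d_min) //; apply: (good_iter hp hM d_gt0 d_min).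
pose f1 := word_map (fun i => z' (inl i)).
pose f2 := word_map (fun j => z' (inr j)).
pose f (r : N) : M := f1 r.1 + f2 r.2.
have f_linear : linear f.
  by move=> a r s; rewrite /f /f1 /f2 /= !word_map_linear scalerDr addrACA.
pose psi_lin := GRing.isLinear.Build k N M *:%R f f_linear.
pose psi : {linear N -> M} := HB.pack f psi_lin.
have fE r : f r = \sum_i (match i with inl i => r.1 0 i | inr j => r.2 0 j end) *: z' i.
  by rewrite big_sumType.
apply: (@unitary_iso_inverse _ _ _ psi).
- move=> [r1 r2] [s1 s2] eq_rs.
  have sum0 : \sum_i (match i with inl i => r1 0 i - s1 0 i | inr j => r2 0 j - s2 0 j end)
      *: z' i = 0.
    transitivity (f (r1, r2) - f (s1, s2)); last by apply/eqP; rewrite subr_eq0; apply/eqP.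
    by rewrite !fE -sumrB; apply: eq_bigr; case=> i _; rewrite scalerBl.
  have rs0 := z'_free _ sum0.
  congr pair; apply/rowP => i; apply/eqP; rewrite -subr_eq0; apply/eqP.
    exact: (rs0 (inl i)).
  exact: (rs0 (inr i)).
- move=> v; have [a ->] := z'_span v.
  exists (\row_i a (inl i), \row_j a (inr j)); rewrite /= fE; apply: eq_bigr.
  by case=> i _; rewrite mxE.
- by move=> [r1 r2]; rewrite /f (FrD hM) -(word_map_Fr hM link1) -(word_map_Fr hM link2).
- by move=> [r1 r2]; rewrite /f (VeD hM) -(word_map_Ve hp hM link1) -(word_map_Ve hp hM link2).
- move=> r s; rewrite [psi r]fE [psi s]fE (pol_suml hM).
  have pol_z' i : lam (z' i) (\sum_i (match i with inl i => s.1 0 i | inr j => s.2 0 j end)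
      *: z' i) = lam (z i) (z (st i)) * match st i with inl i => s.1 0 i | inr j => s.2 0 j end.
    rewrite (pol_sumr hM) (bigD1 (st i)) //= big1 => [|j neq_j].
      by rewrite (pol_scaler hM) z'_pol eqxx addr0 mulrC.
    by rewrite (pol_scaler hM) z'_pol (negPf neq_j) mulr0.
  rewrite big_sumType /=.
  under eq_bigr => i _ do rewrite (pol_scalel hM) pol_z' /= xyj mul1r.
  under [X in _ + X]eq_bigr => j _ do
    rewrite (pol_scalel hM) pol_z' /= (pol_skew hM) xyj mulN1r mulrN.
  rewrite [X in _ + X](reindex (cast_ord (esym size_dw))) /=; last first.
    by apply/onW_bij/inj_card_bij; [exact: cast_ord_inj | rewrite !card_ord size_dw].
  rewrite -big_split; apply: eq_bigr => i _ /=.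
  rewrite (big_pred1 (cast_ord (esym size_dw) i)) => [|j]; last by rewrite /= -[RHS]val_eqE.
  by rewrite cast_ordKV.
- move=> e r; suff sub : (grade N e <= linfun psi @^-1: G e)%VS.
    by move/(subvP sub); rewrite -memv_preim lfunE.
  rewrite subv_add; apply/andP; split; apply/subv_sumP=> j; rewrite -memvE -memv_preim lfunE /=.
    move/eqP <-; rewrite /f /f1 /f2 word_map_delta word_map0 addr0.
    by have := z'_grade (inl j); rewrite /= deg_iter deg_b addbF.
  move/eqP=> odd_j; rewrite /f /f1 /f2 word_map_delta word_map0 add0r.
  have := z'_grade (inr j); rewrite /= deg_iter odd_j -[deg (dual_block b)]/(~~ deg b) deg_b.
  by rewrite addbT negbK.
- move=> [r1 r2]; exists (parity_part false r1, parity_part true r2).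
  exists (parity_part true r1, parity_part false r2).
  have pairD (u : 'rV[k]_(size w)) (v : 'rV[k]_(size (dual w))) : (u, v) = (u, 0) + (0, v).
    by congr pair; rewrite ?addr0 ?add0r.
  split.
  - by rewrite pairD memv_add ?parity_part_inl ?parity_part_inr.
  - by rewrite pairD memv_add ?parity_part_inl ?parity_part_inr.
  by congr pair; [|rewrite [RHS]addrC]; exact: parity_partD.
by case: hM => _ _ [].
Qed.

(** A shift by [n] negates the letters. For odd [n] the shifted block would have the letters and
    degree of the dual block, against [not_dual]. So [n] is even, and [m] divides [2 n]; if 4 did
    not divide [m], then [m] would divide [n], and a full turn would negate letters. *)
Lemma self_dual_w : self_dual w -> (4 %| size w)%N.
Proof.
case=> n dual_w.
have lbl_n j : lbl (j + n) = ~~ lbl j.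
  have lt_j : (j %% m < size w)%N by rewrite size_w ltn_mod.
  have := letter_rotate n lt_j; rewrite -dual_w dual_rev_mkseq letter_rev_mkseq ?ltn_mod //.
  by rewrite -/w mod_w letter_w lbl_mod => ->; rewrite -[RHS]lbl_mod modnDml lbl_mod.
have even_n : ~~ odd n.
  apply/negP => odd_n; have /eqP[] := not_dual n.
  have perd : iter m succ (dual_block b) = dual_block b.
    by rewrite -(dual_iter hp hM d_gt0 d_min) // per.
  have pern : iter m succ (iter n succ b) = iter n succ b by rewrite -iterD addnC iterD per.
  apply: (periodic_block_unique hp hM d_gt0 d_min _ _ _ m_gt0 pern perd).
  - exact: (good_iter hp hM d_gt0 d_min).
  - exact: (good_dual hp hM d_gt0).
  - by rewrite deg_iter odd_n -[RHS]/(~~ deg b).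
  move=> j _; rewrite lbl_iter lbl_n -(dual_iter hp hM d_gt0 d_min) //.
  by rewrite (dual_letter hp hM d_gt0 d_min) //; apply: (good_iter hp hM d_gt0 d_min).
have m_2n : (m %| n + n)%N.
  by apply: letter_period => [|j]; rewrite ?addnn ?odd_double // -addnn addnA !lbl_n negbK.
rewrite size_w; apply: contraT => m4.
have m_n : (m %| n)%N.
  have [l mE] : exists l, m = l.*2.
    by exists m./2; rewrite -[LHS]odd_double_half (negPf period_even).
  have [a nE] : exists a, n = a.*2.
    by exists n./2; rewrite -[LHS]odd_double_half (negPf even_n).
  have odd_l : odd l.
    apply: contraNT m4 => even_l; rewrite mE -(odd_double_half l) (negPf even_l) add0n.
    by rewrite -!muln2 -mulnA dvdn_mull.
  move: m_2n; rewrite mE nE addnn -!muln2 !dvdn_pmul2r // Gauss_dvdl //.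
  by rewrite coprimen2.
by have := lbl_n 0%N; rewrite add0n -lbl_mod (eqP m_n); case: (lbl _).
Qed.

Lemma bicycle_classification :
  iso_unitary_bicycle p M \/ iso_Serre_unicycle p M \/ iso_Serre_bicycle p M.
Proof.
have isoM := bicycle_case.
have even_w : ~~ odd (size w) by rewrite size_w period_even.
have w_neq0 : w <> [::] by move=> w0; have := size_w; rewrite w0 /=; lia.
case: (classic (primitive w)) => [prim_w|not_prim].
  case: (classic (self_dual w)) => [sd|not_sd]; last by left; exists w.
  by right; left; exists w; split=> //; apply: self_dual_w.
right; right.
have [t [r [r_gt1 wE]]] : exists t r, (1 < r)%N /\ w = power t r.
  apply: NNPP => no; apply: not_prim; split=> // t r r_gt1 wE.
  by apply: no; exists t, r.
have [odd_t r2 mE _] := w_power wE r_gt1.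
have wtt : w = t ++ t by rewrite wE r2 /power /= cats0.
exists t; split=> //; last by rewrite -wtt.
split=> [t0|v s s_gt1 tE]; first by rewrite t0 in odd_t.
have wv : w = power v (s + s) by rewrite wtt tE /power nseqD flatten_cat.
(* Every exponent above 1 for [w] is 2, so a power [s > 1] inside [t] would give the excluded
   exponent [2 s]. *)
by have [_ s2 _ _] := w_power wv (leq_trans s_gt1 (leq_addr s s)); lia.
Qed.

End Assembly.

Theorem corollary4p22 (k : closedFieldType) (p : nat)
    (hp : p \in [pchar k]) (hp2 : (2 < p)%N)
    (c : word -> k)
    (hc : forall y : word, odd (size y) -> unicycle_constant p (size y) (c y))
    (M : unitary_data k) (hM : is_unitary_BT1 p M)
    (hindec : indecomposable p M) :
  iso_unitary_unicycle p c M \/ iso_unitary_bicycle p M \/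
  iso_Serre_unicycle p M \/ iso_Serre_bicycle p M.
Proof.
have [d d_gt0 [d_min [b0 gb0]]] := minimal_blocks hp hM (proj1 hindec).
have [b [m [gb deg_b m_gt0 per m_min]]] := periodic_block hp hM d_gt0 d_min gb0.
have [[n dual_b]|not_dual] := classic (exists n, iter n (@succ k M) b = dual_block b).
  left; have dual_b' : iter (n %% m) (@succ k M) b = dual_block b.
    by rewrite iter_periodic.
  exact: (unicycle_case hp hp2 hM hindec d_gt0 d_min gb deg_b m_gt0 per m_min hc
    (ltn_pmod n m_gt0) dual_b').
right; apply: (bicycle_classification hp hp2 hM hindec d_gt0 d_min gb deg_b m_gt0 per m_min).
by move=> n; apply/eqP => dual_b; apply: not_dual; exists n.
Qed.
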